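(* Suppose $n \geq 3$ and let $N = \binom{n+1}{2}$. There is a short exact sequence $$1 \to \mathbb{Z}_2 \ltimes \mathbb{Z}^{N-1} \to \mathrm{Aut}(P(A_n)) \to \mathrm{Aut}(P(A_n)/Z) \to 1$$ in which the third map $\mathrm{Aut}(P(A_n)) \to \mathrm{Aut}(P(A_n)/Z)$ is the natural one (the one induced by passing to the quotient by the center).
   Context: $P(A_n)$ is the pure braid group on $n+1$ strands, i.e. the subgroup of the braid group on $n+1$ strands $A(A_n)\cong \mathrm{Mod}(D_{n+1},\partial D_{n+1})$ consisting of the elements fixing each puncture of the disk $D_{n+1}$ with $n+1$ punctures. $Z$ is the center of $P(A_n)$, which is infinite cyclic. $\mathbb{Z}_2$ is the group of order $2$ and $\mathbb{Z}_2\ltimes\mathbb{Z}^{N-1}$ denotes a semidirect product with normal subgroup $\mathbb{Z}^{N-1}$ (the action is not specified in the statement). *)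

(* Defs.v *)
From HB Require Import structures.
From mathcomp Require Import all_boot all_fingroup all_algebra.
From mathcomp Require Import zify boolp generic_quotient.

Set Implicit Arguments.
Unset Strict Implicit.
Unset Printing Implicit Defensive.

Import GroupScope.
Local Open Scope group_scope.
Local Open Scope quotient_scope.

Notation "{ 'grouphom' G -> H }" := (UMagmaMorphism.type G H)
  (at level 0, G at level 98, H at level 99,
   format "{ 'grouphom'  G  ->  H }") : type_scope.

(* 1 -> A -> B -> C -> 1 *)
Definition short_exact (A B C : groupType)
    (f : {grouphom A -> B}) (g : {grouphom B -> C}) : Prop :=
  [/\ injective f,
      forall b, g b = 1 <-> exists a, f a = b
    & forall c, exists b, g b = c].
Arguments short_exact {A B C} f g.

(* The presented group < X | R >: a letter (x, true) stands for x, a letter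
   (x, false) for x^-1, and R u v for the relation u = v. *)
Section PresentedGroup.
Variables (X : choiceType) (R : seq (X * bool) -> seq (X * bool) -> Prop).
Local Notation word := (seq (X * bool)).

Inductive pres_cong : word -> word -> Prop :=
| pres_cong_refl u : pres_cong u u
| pres_cong_sym u v : pres_cong u v -> pres_cong v u
| pres_cong_trans v u w : pres_cong u v -> pres_cong v w -> pres_cong u w
| pres_cong_cat u u' v v' :
    pres_cong u u' -> pres_cong v v' -> pres_cong (u ++ v) (u' ++ v')
| pres_cong_cancel x b : pres_cong [:: (x, b); (x, ~~ b)] [::]
| pres_cong_rel u v : R u v -> pres_cong u v.

Definition pres_eqv : rel word := fun u v => `[< pres_cong u v >].

Fact pres_eqv_refl : reflexive pres_eqv.
Proof. by move=> u; apply/asboolP; apply: pres_cong_refl. Qed.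
Fact pres_eqv_sym : symmetric pres_eqv.
Proof.
by move=> u v; apply/asboolP/asboolP; apply: pres_cong_sym.
Qed.
Fact pres_eqv_trans : transitive pres_eqv.
Proof.
move=> v u w /asboolP uv /asboolP vw; apply/asboolP.
exact: pres_cong_trans uv vw.
Qed.
Canonical pres_equiv :=
  EquivRel pres_eqv pres_eqv_refl pres_eqv_sym pres_eqv_trans.

Definition presented := {eq_quot pres_equiv}.
HB.instance Definition _ := Choice.on presented.
HB.instance Definition _ := Quotient.on presented.
HB.instance Definition _ := EqQuotient.on presented.

Definition word_inv (u : word) : word := rev [seq (a.1, ~~ a.2) | a <- u].

Definition pres_mul (x y : presented) : presented :=
  \pi_presented (repr x ++ repr y).
Definition pres_one : presented := \pi_presented [::].
Definition pres_inv (x : presented) : presented := \pi_presented (word_inv (repr x)).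

Lemma pres_eqP u v : reflect (pres_cong u v) (u == v %[mod presented]).
Proof. by rewrite piE; apply: asboolP. Qed.

Lemma pres_piP u v : (\pi u = \pi v :> presented) <-> pres_cong u v.
Proof. by split=> [/eqP/pres_eqP|/pres_eqP/eqP]. Qed.

Lemma pres_repr u : pres_cong (repr (\pi u : presented)) u.
Proof. by apply/pres_piP; rewrite reprK. Qed.

Lemma word_inv_cat u v : word_inv (u ++ v) = word_inv v ++ word_inv u.
Proof. by rewrite /word_inv map_cat rev_cat. Qed.

Lemma word_invK : involutive word_inv.
Proof.
move=> u; rewrite /word_inv map_rev revK -map_comp -[RHS]map_id.
by apply: eq_map => -[x b] /=; rewrite negbK.
Qed.

Lemma word_mulV u : pres_cong (u ++ word_inv u) [::].
Proof.
elim: u => [|[x b] u IHu]; first exact: pres_cong_refl.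
rewrite -[_ :: u]cat1s word_inv_cat -catA [u ++ _]catA.
apply: pres_cong_trans (pres_cong_cancel x b).
apply: (pres_cong_cat (pres_cong_refl [:: (x, b)])).
exact: (pres_cong_cat IHu (pres_cong_refl [:: (x, ~~ b)])).
Qed.

Lemma word_mulVl u : pres_cong (word_inv u ++ u) [::].
Proof. by rewrite -{2}[u]word_invK; apply: word_mulV. Qed.

Fact pres_mulA : associative pres_mul.
Proof.
move=> x y z; apply/pres_piP.
apply: (@pres_cong_trans (repr x ++ (repr y ++ repr z))).
  exact: pres_cong_cat (pres_cong_refl _) (pres_repr _).
rewrite catA; apply: pres_cong_sym.
exact: pres_cong_cat (pres_repr _) (pres_cong_refl _).
Qed.

Fact pres_mul1 : left_id pres_one pres_mul.
Proof.
move=> x; rewrite -[RHS]reprK; apply/pres_piP.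
exact: (pres_cong_cat (pres_repr [::]) (pres_cong_refl _)).
Qed.

Fact pres_1mul : right_id pres_one pres_mul.
Proof.
move=> x; rewrite -[RHS]reprK; apply/pres_piP.
have := pres_cong_cat (pres_cong_refl (repr x)) (pres_repr [::]).
by rewrite cats0.
Qed.

Fact pres_mulV : left_inverse pres_one pres_inv pres_mul.
Proof.
move=> x; apply/pres_piP; apply: pres_cong_trans (word_mulVl (repr x)).
exact: pres_cong_cat (pres_repr _) (pres_cong_refl _).
Qed.

Fact pres_Vmul : right_inverse pres_one pres_inv pres_mul.
Proof.
move=> x; apply/pres_piP; apply: pres_cong_trans (word_mulV (repr x)).
exact: pres_cong_cat (pres_cong_refl _) (pres_repr _).
Qed.

HB.instance Definition _ := isGroup.Build presented
  pres_mulA pres_mul1 pres_1mul pres_mulV pres_Vmul.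

Lemma pres_mulE u v : (\pi u : presented) * \pi v = \pi_presented (u ++ v).
Proof. by apply/pres_piP/pres_cong_cat; apply: pres_repr. Qed.

Section Eval.
Variables (H : groupType) (f : X -> H).

Definition word_eval (u : word) : H :=
  \prod_(a <- u) (if a.2 then f a.1 else (f a.1)^-1).

(* The homomorphism < X | R > -> H extending f, when f respects R. *)
Definition pres_eval (x : presented) : H := word_eval (repr x).

Lemma word_eval_cat u v : word_eval (u ++ v) = word_eval u * word_eval v.
Proof. by rewrite /word_eval big_cat. Qed.

Hypothesis fR : forall u v, R u v -> word_eval u = word_eval v.

Lemma word_eval_cong u v : pres_cong u v -> word_eval u = word_eval v.
Proof.
elim=> {u v} //.
- by move=> v u w _ -> _ ->.
- by move=> u u' v v' _ Eu _ Ev; rewrite !word_eval_cat Eu Ev.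
- move=> x b; rewrite /word_eval big_cons big_seq1 big_nil /=.
  by case: b; rewrite /= (mulgV, mulVg).
Qed.

Lemma pres_eval_pi u : pres_eval (\pi u) = word_eval u.
Proof. exact: word_eval_cong (pres_repr u). Qed.

Lemma pres_evalM : {morph pres_eval : x y / x * y}.
Proof.
move=> x y; rewrite -{1}[x]reprK -{1}[y]reprK pres_mulE pres_eval_pi.
exact: word_eval_cat.
Qed.

Lemma pres_eval1 : pres_eval 1 = 1.
Proof. by rewrite pres_eval_pi /word_eval big_nil. Qed.

End Eval.
End PresentedGroup.

(* The Artin group of type A_n, that is, the braid group on n + 1 strands. *)
Section Braid.
Variable n : nat.

Variant artin_rel : seq ('I_n * bool) -> seq ('I_n * bool) -> Prop :=
| artin_comm (i j : 'I_n) of (i.+1 < j)%N :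
    artin_rel [:: (i, true); (j, true)] [:: (j, true); (i, true)]
| artin_braid (i j : 'I_n) of j = i.+1 :> nat :
    artin_rel [:: (i, true); (j, true); (i, true)]
              [:: (j, true); (i, true); (j, true)].

Definition braid := presented artin_rel.
HB.instance Definition _ := monoid.Group.on braid.

(* The half-twist sigma_i exchanges the punctures i and i + 1. *)
Definition adj_tperm (i : 'I_n) : 'S_n.+1 :=
  tperm (widen_ord (leqnSn n) i) (lift ord0 i).

(* The action of a braid on the n + 1 punctures. *)
Definition braid_perm (b : braid) : 'S_n.+1 := pres_eval adj_tperm b.

Lemma artin_rel_perm u v :
  artin_rel u v -> word_eval adj_tperm u = word_eval adj_tperm v.
Proof.
case=> i j ij; rewrite /word_eval !big_cons !big_nil /= ?mulg1.
  have D : (adj_tperm j) ^ (adj_tperm i) = adj_tperm j.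
    by rewrite tpermJ !tpermD // -val_eqE /= /bump /=; lia.
  by rewrite -{1}D conjgE !mulgA mulgV mul1g.
have E : lift ord0 i = widen_ord (leqnSn n) j.
  by apply: val_inj; rewrite /= /bump /= ij.
rewrite /adj_tperm -E; set a := widen_ord _ i; set b := lift ord0 i.
set c := lift ord0 j.
have ab : a != b by rewrite -val_eqE /= /bump /=; lia.
have bc : b != c by rewrite -val_eqE /= /bump /=; lia.
have ac : a != c by rewrite -val_eqE /= /bump /=; lia.
have L : tperm a b * (tperm b c * tperm a b) = tperm a c.
  rewrite -{1}[tperm a b]tpermV -conjgE tpermJ tpermR tpermD //.
rewrite L -{1}[tperm b c]tpermV -conjgE tpermJ tpermL tpermD //; last first.
  by rewrite eq_sym.
by rewrite eq_sym.
Qed.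

Lemma braid_permM : {morph braid_perm : b c / b * c}.
Proof. exact: pres_evalM artin_rel_perm. Qed.
Lemma braid_perm1 : braid_perm 1 = 1.
Proof. exact: pres_eval1 artin_rel_perm. Qed.
HB.instance Definition _ := isUMagmaMorphism.Build braid 'S_n.+1
  braid_perm (braid_perm1, braid_permM).

Definition is_pure : pred braid := fun b => [forall k, braid_perm b k == k].

Record pure_braid := PureBraid { pure_val :> braid; _ : is_pure pure_val }.
HB.instance Definition _ := [isSub for pure_val].
HB.instance Definition _ := [Choice of pure_braid by <:].

Fact is_pure_closed : group_closed is_pure.
Proof.
have pureE b : (b \in is_pure) = (braid_perm b == 1).
  apply/forallP/eqP => [bP|-> k]; last by rewrite perm1.
  by apply/permP=> k; rewrite perm1; apply/eqP.
split; first by rewrite pureE gmulf1.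
move=> b c; rewrite !pureE => /eqP Eb /eqP Ec; apply/eqP.
by rewrite gmulfF /= Eb Ec divgg.
Qed.
HB.instance Definition _ :=
  SubChoice_isSubGroup.Build braid is_pure pure_braid is_pure_closed.

End Braid.

Section Automorphisms.
Variable G : groupType.

Definition is_aut : pred (G -> G) :=
  fun f => `[< {morph f : x y / x * y} /\ bijective f >].

Record group_aut := Aut { aut_val :> G -> G; _ : is_aut aut_val }.
HB.instance Definition _ := [isSub for aut_val].
HB.instance Definition _ := [Choice of group_aut by <:].

Lemma autM (f : group_aut) : {morph f : x y / x * y}.
Proof. by case: f => f /= /asboolP[]. Qed.
Lemma aut_bij (f : group_aut) : bijective f.
Proof. by case: f => f /= /asboolP[]. Qed.
Lemma autP (f g : group_aut) : f =1 g -> f = g.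
Proof. by move=> fg; apply/val_inj/funext. Qed.

Fact aut_one_proof : is_aut id.
Proof. by apply/asboolP; split=> //; exists id. Qed.
Definition aut_one : group_aut := Aut aut_one_proof.

Fact aut_mul_proof (f g : group_aut) : is_aut (f \o g).
Proof.
apply/asboolP; split=> [x y|]; first by rewrite /= !autM.
by apply: bij_comp; apply: aut_bij.
Qed.
Definition aut_mul (f g : group_aut) : group_aut := Aut (aut_mul_proof f g).

Fact aut_inv_ex (f : group_aut) : exists g : group_aut, cancel f g /\ cancel g f.
Proof.
have [g fK gK] := aut_bij f.
suff gP : is_aut g by exists (Aut gP).
apply/asboolP; split; last by exists f.
by move=> x y; rewrite -{1}[x]gK -{1}[y]gK -autM fK.
Qed.
Definition aut_inv (f : group_aut) : group_aut := sval (cid (aut_inv_ex f)).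
Lemma autK (f : group_aut) : cancel f (aut_inv f).
Proof. by rewrite /aut_inv; case: cid => g []. Qed.
Lemma autVK (f : group_aut) : cancel (aut_inv f) f.
Proof. by rewrite /aut_inv; case: cid => g []. Qed.

Fact aut_mulA : associative aut_mul. Proof. by move=> f g h; apply: autP. Qed.
Fact aut_mul1 : left_id aut_one aut_mul. Proof. by move=> f; apply: autP. Qed.
Fact aut_1mul : right_id aut_one aut_mul. Proof. by move=> f; apply: autP. Qed.
Fact aut_mulV : left_inverse aut_one aut_inv aut_mul.
Proof. by move=> f; apply: autP; apply: autK. Qed.
Fact aut_Vmul : right_inverse aut_one aut_inv aut_mul.
Proof. by move=> f; apply: autP; apply: autVK. Qed.

HB.instance Definition _ := isGroup.Build group_aut
  aut_mulA aut_mul1 aut_1mul aut_mulV aut_Vmul.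

End Automorphisms.

(* (q, k) stands for the product k q, and act is the conjugation action of Q on
   the normal subgroup K: (k q) (k' q') = k (q k' q^-1) q q'. *)
Record semidirect (Q K : groupType) (act : {grouphom Q -> group_aut K}) :=
  Semidirect { sd_q : Q; sd_k : K }.
Arguments semidirect {Q K} act.
Arguments Semidirect {Q K act} sd_q sd_k.

Section SemidirectProduct.
Variables (Q K : groupType) (act : {grouphom Q -> group_aut K}).
Local Notation semidirect := (semidirect act).

Definition sd_pair (x : semidirect) := (sd_q x, sd_k x).
Definition sd_of_pair (p : Q * K) : semidirect := Semidirect p.1 p.2.
Fact sd_pairK : cancel sd_pair sd_of_pair. Proof. by case. Qed.
HB.instance Definition _ := Choice.copy semidirect (can_type sd_pairK).

Definition sd_mul (x y : semidirect) : semidirect :=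
  Semidirect (sd_q x * sd_q y) (sd_k x * act (sd_q x) (sd_k y)).
Definition sd_one : semidirect := Semidirect 1 1.
Definition sd_inv (x : semidirect) : semidirect :=
  Semidirect (sd_q x)^-1 (act (sd_q x)^-1 (sd_k x)^-1).

Lemma sd_aut1 (f : group_aut K) : f 1 = 1.
Proof. by apply: (mulgI (f 1)); rewrite -autM !mulg1. Qed.

Fact sd_mulA : associative sd_mul.
Proof.
by move=> x y z; rewrite /sd_mul /= gmulfM autM !mulgA.
Qed.
Fact sd_mul1 : left_id sd_one sd_mul.
Proof. by case=> q k; rewrite /sd_mul /= gmulf1 !mul1g. Qed.
Fact sd_1mul : right_id sd_one sd_mul.
Proof. by case=> q k; rewrite /sd_mul /= sd_aut1 !mulg1. Qed.
Fact sd_mulV : left_inverse sd_one sd_inv sd_mul.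
Proof. by case=> q k; rewrite /sd_mul /= -autM !mulVg sd_aut1. Qed.
Fact sd_Vmul : right_inverse sd_one sd_inv sd_mul.
Proof.
case=> q k; rewrite /sd_mul /= mulgV.
have -> : act q (act q^-1 k^-1) = (act q * act q^-1) k^-1 by [].
by rewrite -gmulfM mulgV gmulf1 mulgV.
Qed.

HB.instance Definition _ := isGroup.Build semidirect
  sd_mulA sd_mul1 sd_1mul sd_mulV sd_Vmul.

End SemidirectProduct.


Section CentralQuotient.
Variable G : groupType.

Definition is_center : pred G := fun z => `[< forall x, commute z x >].

Lemma centerP z : reflect (forall x, z * x = x * z) (z \in is_center).
Proof. exact: asboolP. Qed.

Fact center_closed : group_closed is_center.
Proof.
split=> [|y z /centerP Cy /centerP Cz]; apply/centerP=> x.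
  by rewrite mul1g mulg1.
by rewrite -mulgA -[z^-1 * x]invgK invgM invgK -Cz invgM invgK mulgA Cy mulgA.
Qed.

Definition center_eqv : rel G := fun x y => x^-1 * y \in is_center.

Fact center_eqv_refl : reflexive center_eqv.
Proof. by move=> x; rewrite /center_eqv mulVg; case: center_closed. Qed.
Fact center_eqv_sym : symmetric center_eqv.
Proof.
suff S x y : center_eqv x y -> center_eqv y x by move=> x y; apply/idP/idP; apply: S.
rewrite /center_eqv => xy; have [C1 CF] := center_closed.
by have := CF _ _ C1 xy; rewrite mul1g invgM invgK.
Qed.
Fact center_eqv_trans : transitive center_eqv.
Proof.
move=> y x z xy yz; rewrite /center_eqv.
have := group_closedM center_closed xy yz.
by rewrite mulgA mulgK.
Qed.
Canonical center_equiv :=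
  EquivRel center_eqv center_eqv_refl center_eqv_sym center_eqv_trans.

Definition central_quotient := {eq_quot center_equiv}.
HB.instance Definition _ := Choice.on central_quotient.
HB.instance Definition _ := Quotient.on central_quotient.
HB.instance Definition _ := EqQuotient.on central_quotient.

Definition cq_mul (x y : central_quotient) : central_quotient :=
  \pi_central_quotient (repr x * repr y).
Definition cq_one : central_quotient := \pi_central_quotient 1.
Definition cq_inv (x : central_quotient) : central_quotient :=
  \pi_central_quotient (repr x)^-1.

Lemma cq_piP x y :
  (\pi x = \pi y :> central_quotient) <-> exists2 z, z \in is_center & y = x * z.
Proof.
split=> [/eqP|[z Cz ->]].
  by rewrite piE => xy; exists (x^-1 * y); rewrite // mulgA mulgV mul1g.
by apply/eqP; rewrite piE /= /center_eqv mulgA mulVg mul1g.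
Qed.

Lemma cq_repr x :
  exists2 z, z \in is_center & repr (\pi x : central_quotient) = x * z.
Proof. by apply/cq_piP; rewrite reprK. Qed.

Lemma cq_mulE x y : cq_mul (\pi x) (\pi y) = \pi_central_quotient (x * y).
Proof.
have [z Cz Ez] := cq_repr x; have [t Ct Et] := cq_repr y.
rewrite /cq_mul Ez Et; apply/esym/cq_piP; exists (z * t).
  exact: group_closedM center_closed _ _ Cz Ct.
by rewrite -!mulgA; congr (_ * _); rewrite !mulgA (centerP _ Cz).
Qed.

Lemma cq_invE x : cq_inv (\pi x) = \pi x^-1.
Proof.
have [z Cz Ez] := cq_repr x; rewrite /cq_inv Ez; apply/esym/cq_piP.
exists z^-1; first exact: group_closedV center_closed _ Cz.
by rewrite -invgM (centerP _ Cz).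
Qed.

Fact cq_mulA : associative cq_mul.
Proof. by elim/quotW=> x; elim/quotW=> y; elim/quotW=> z; rewrite !cq_mulE mulgA. Qed.
Fact cq_mul1 : left_id cq_one cq_mul.
Proof. by elim/quotW=> x; rewrite cq_mulE mul1g. Qed.
Fact cq_1mul : right_id cq_one cq_mul.
Proof. by elim/quotW=> x; rewrite cq_mulE mulg1. Qed.
Fact cq_mulV : left_inverse cq_one cq_inv cq_mul.
Proof. by elim/quotW=> x; rewrite cq_invE cq_mulE mulVg. Qed.
Fact cq_Vmul : right_inverse cq_one cq_inv cq_mul.
Proof. by elim/quotW=> x; rewrite cq_invE cq_mulE mulgV. Qed.

HB.instance Definition _ := isGroup.Build central_quotient
  cq_mulA cq_mul1 cq_1mul cq_mulV cq_Vmul.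

Definition cq_proj (x : G) : central_quotient := \pi x.

Lemma cq_projM : {morph cq_proj : x y / x * y}.
Proof. by move=> x y; rewrite /cq_proj -cq_mulE. Qed.
HB.instance Definition _ := isUMagmaMorphism.Build G central_quotient
  cq_proj (erefl : cq_proj 1 = 1, cq_projM).

(* The automorphism x Z |-> f x Z of G / Z(G) induced by f. *)
Section Induced.
Variable f : group_aut G.

Definition cq_fun (x : central_quotient) : central_quotient :=
  cq_proj (f (repr x)).

Lemma aut_center z : z \in is_center -> f z \in is_center.
Proof.
move=> /centerP Cz; apply/centerP=> x; have [g _ gK] := aut_bij f.
by rewrite -[x]gK -!autM Cz.
Qed.

Lemma cq_funE x : cq_fun (cq_proj x) = cq_proj (f x).
Proof.
rewrite /cq_fun /cq_proj; have [z Cz ->] := cq_repr x; apply/esym/cq_piP.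
by exists (f z); rewrite ?autM // aut_center.
Qed.
End Induced.

Fact cq_aut_proof (f : group_aut G) : is_aut (cq_fun f).
Proof.
apply/asboolP; split.
  elim/quotW=> x; elim/quotW=> y.
  by rewrite -!/(cq_proj _) -gmulfM !cq_funE autM gmulfM.
by exists (cq_fun f^-1); elim/quotW=> x;
   rewrite -!/(cq_proj _) !cq_funE ?autK ?autVK.
Qed.

Definition natural_aut (f : group_aut G) : group_aut central_quotient :=
  Aut (cq_aut_proof f).

Lemma natural_autE (f : group_aut G) x : natural_aut f (cq_proj x) = cq_proj (f x).
Proof. exact: cq_funE. Qed.

Lemma natural_autM : {morph natural_aut : f g / f * g}.
Proof.
move=> f g; apply: autP; elim/quotW=> x; rewrite -!/(cq_proj _).
by rewrite natural_autE /= !cq_funE.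
Qed.
Lemma natural_aut1 : natural_aut 1 = 1.
Proof.
by apply: autP; elim/quotW=> x; rewrite -!/(cq_proj _) natural_autE.
Qed.
HB.instance Definition _ := isUMagmaMorphism.Build
  (group_aut G) (group_aut central_quotient) natural_aut (natural_aut1, natural_autM).

End CentralQuotient.

(* Main.v *)
Require Import Defs.
From mathcomp Require Import all_boot all_algebra.
From HB Require Import structures.
From mathcomp Require Import all_fingroup zify boolp generic_quotient ring.

(** The center of the pure braid group P on n + 1 strands is infinite cyclic and
    is a direct factor of P; once this is known, the sequence is formal.

    Suppose that P has a central element z, elements a_i indexed by N - 1 indices,
    and homomorphisms t_i, u : P -> int dual to the a_i and to z, such that the a_i
    and z generate P and such that a central element killed by u is trivial.
    Then the center is generated by z, the homomorphisms from P to int are exactly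
    the integer combinations of the t_i and u, and every x in P is uniquely the
    product of an element of ker u and a power of z. So an automorphism of P / Z,
    which acts on ker u = P / Z, extends to P by fixing z: the natural map is onto
    (natural_aut_surj). An automorphism f in its kernel has the form
    x |-> x z^(tau x) with tau a homomorphism to int; it sends z to z^(1 + tau z),
    so 1 + tau z is a sign e, while the integers tau a_i are arbitrary
    (natural_aut_kernel). Composing two such maps gives the
    semidirect product law in which e acts on the vector (tau a_i) by
    multiplication (transv_comp). The result is split_center_exact.

    These data are constructed by induction on the number of strands. Combing
    identifies the pure braids on p + 2 strands with the semidirect product of the
    pure braids on p + 1 strands and the free group F on x_0, ..., x_p, the last
    strand moving around the others; the action is Artin's. The map from the
    semidirect product to braids comes from relations among words (add_strand_push).
    Its inverse comes from the action of the braid group on the cosets of the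
    stabilizer of the last puncture: the coset representatives
    sigma_p ... sigma_k turn this action into an explicit cocycle with values in
    the semidirect product of F and the braid group on p + 1 strands, and the braid
    relations for the cocycle are checked case by case (gen_cocycle_commute,
    gen_cocycle_braid). The identity coset_formula then shows that a braid fixing
    the last puncture is recovered from its cocycle, so the map is bijective
    (pure_comb_fun_bij).

    For the induction step, the full twist (sigma_0 ... sigma_(p - 1))^(p + 1)
    acts on F as conjugation by w^-1, where w = x_0 ... x_p, and w is fixed by
    all braids. Hence, if z is the full twist on p + 1 strands, w z is central in
    the semidirect product; it is the full twist on p + 2 strands (full_twistS).
    A central element killed by u has, by induction, no pure braid component, and
    an element of F that commutes with all the free generators is trivial, as there
    are at least two of them (free_centerless). The new dual homomorphisms are
    exponent sums on F, which pure braids preserve because they send each generator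
    to a conjugate of itself; they are corrected by u so as to vanish on w z
    (split_center_extend). Pascal's rule for C(p + 1, 2) counts the generators. *)

Set Implicit Arguments.
Unset Strict Implicit.
Unset Printing Implicit Defensive.
Import GRing.Theory Num.Theory.

(** * Homomorphisms and presented groups *)

Section Homs.
Import GroupScope.

Section HomOf.
Variables (G H : groupType) (f : G -> H).
Hypothesis fM : {morph f : x y / x * y}.

Fact hom_of1 : f 1 = 1.
Proof. by apply: (mulgI (f 1)); rewrite -fM !mulg1. Qed.

Definition hom_of : {grouphom G -> H} :=
  HB.pack f (isUMagmaMorphism.Build G H f (hom_of1, fM)).

Lemma hom_ofE x : hom_of x = f x. Proof. by []. Qed.
End HomOf.

Lemma aut_mulE (G : groupType) (f g : group_aut G) x : (f * g) x = f (g x).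
Proof. by []. Qed.

Section Presented.
Variables (X : choiceType) (R : seq (X * bool) -> seq (X * bool) -> Prop).

Definition pgen (x : X) : presented R := (\pi_(presented R) [:: (x, true)])%qT.

Lemma pgenV x : (\pi_(presented R) [:: (x, false)])%qT = (pgen x)^-1.
Proof.
apply/esym/mulg1_eq; rewrite pres_mulE.
by apply/pres_piP; apply: (pres_cong_cancel R x true).
Qed.

Lemma presented_ind (S : presented R -> Prop) :
  S 1 -> (forall x y, S x -> S y -> S (x * y)) ->
  (forall x, S x -> S x^-1) -> (forall i, S (pgen i)) -> forall x, S x.
Proof.
move=> S1 SM SV Sg x; rewrite -[x]reprK; elim: (repr x) => [|[i b] w IHw] //.
rewrite -cat1s -pres_mulE; apply: SM IHw.
by case: b; rewrite ?pgenV; [|apply: SV]; apply: Sg.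
Qed.

Lemma pi_word u : (\pi_(presented R) u)%qT = word_eval pgen u.
Proof.
elim: u => [|[i b] u IHu]; first by rewrite /word_eval big_nil.
rewrite -cat1s -pres_mulE IHu word_eval_cat; congr (_ * _).
by rewrite /word_eval big_seq1 /=; case: b; rewrite // pgenV.
Qed.

Lemma pres_relE u v : R u v -> word_eval pgen u = word_eval pgen v.
Proof. by move=> Ruv; rewrite -!pi_word; apply/pres_piP/pres_cong_rel. Qed.

Variables (H : groupType) (f : X -> H).
Hypothesis fR : forall u v, R u v -> word_eval f u = word_eval f v.

Definition pres_hom : {grouphom presented R -> H} := hom_of (pres_evalM fR).

Lemma pres_homE i : pres_hom (pgen i) = f i.
Proof. by rewrite hom_ofE pres_eval_pi // /word_eval big_seq1. Qed.
End Presented.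

End Homs.

(** * Integer powers and integer-valued homomorphisms *)

Section IntPowers.
Import GroupScope.
Variable G : groupType.
Implicit Types (x y : G) (m : int).

Definition expgz x m : G :=
  match m with Posz k => x ^+ k | Negz k => x ^- k.+1 end.

(** Every integer is a difference of two natural numbers, and in this form the laws
    of exponents need no discussion of signs. *)
Lemma expgz_sub x (a b : nat) : expgz x (a%:Z - b%:Z)%R = x ^+ a * x ^- b.
Proof.
have [ba | ab] := leqP b a; first by rewrite subzn //= expgnFr.
have -> : (a%:Z - b%:Z)%R = Negz (b - a).-1 by lia.
rewrite /= prednK ?subn_gt0 // expgnFr 1?ltnW //.
by rewrite invgF.
Qed.

Lemma expgzD x m1 m2 : expgz x (m1 + m2)%R = expgz x m1 * expgz x m2.
Proof.
have D m : exists a b : nat, m = (a%:Z - b%:Z)%R.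
  by case: m => k; [exists k, 0 | exists 0, k.+1]; lia.
have [[a1 [b1 ->]] [a2 [b2 ->]]] := (D m1, D m2).
have -> : (a1%:Z - b1%:Z + (a2%:Z - b2%:Z) =
           (a1 + a2)%N%:Z - (b2 + b1)%N%:Z)%R by lia.
rewrite !expgz_sub !expgnDr invgM !mulgA -[in RHS](mulgA (x ^+ a1)).
have C : commute (x ^+ a2) (x ^- b1) by apply/commuteV/commuteX2.
by rewrite -C !mulgA.
Qed.

Lemma expgz0 x : expgz x 0 = 1. Proof. by []. Qed.
Lemma expgz1 x : expgz x 1 = x. Proof. by []. Qed.
Lemma expgzN x m : expgz x (- m)%R = (expgz x m)^-1.
Proof. by apply/esym/mulg1_eq; rewrite -expgzD subrr. Qed.

Lemma expgz_commute x y m : commute y x -> commute y (expgz x m).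
Proof. by case: m => k xy /=; [|apply: commuteV]; apply: commuteX. Qed.

End IntPowers.

Section Additive.
Import GroupScope.
Variables (G : groupType) (u : G -> int).
Hypothesis uM : {morph u : x y / x * y >-> (x + y)%R}.

Lemma additive1 : u 1 = 0%R.
Proof. by apply: (addrI (u 1)); rewrite -uM mulg1 addr0. Qed.
Lemma additiveV x : u x^-1 = (- u x)%R.
Proof. by apply: (addrI (u x)); rewrite -uM mulgV subrr additive1. Qed.
Lemma additiveX x m : u (expgz x m) = (m * u x)%R.
Proof.
suff H k : u (x ^+ k) = (k%:Z * u x)%R.
  by case: m => k /=; rewrite ?additiveV H // NegzE mulNr.
elim: k => [|k IH]; first by rewrite additive1 mul0r.
by rewrite expgS uM IH -add1n PoszD mulrDl mul1r.
Qed.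
End Additive.

Section MorphPowers.
Import GroupScope.
Variables (G : groupType) (f : group_aut G).
Lemma autV x : f x^-1 = (f x)^-1.
Proof. by apply/esym/mulg1_eq; rewrite -autM mulgV sd_aut1. Qed.
Lemma autX x m : f (expgz x m) = expgz (f x) m.
Proof.
suff H k : f (x ^+ k) = f x ^+ k by case: m => k /=; rewrite ?autV H.
by elim: k => [|k IH]; rewrite ?sd_aut1 // !expgS autM IH.
Qed.
End MorphPowers.

(** * The natural map on automorphisms when the center splits off *)

(** A central infinite cyclic direct factor, spanned by [sc_z], together with a
    basis of the abelianization: [sc_t] and [sc_u] are dual to the generators
    [sc_a] and [sc_z], so that these are independent modulo commutators. By
    [sc_center] the center is no larger than the powers of [sc_z]; in this form
    the condition passes easily through an induction, since the component of a
    central element in a quotient is again central. *)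
Record split_center (P : groupType) (I : finType) := SplitCenter {
  sc_z : P;
  sc_a : I -> P;
  sc_t : I -> P -> int;
  sc_u : P -> int;
  sc_tM : forall i, {morph sc_t i : x y / (x * y)%g >-> (x + y)%R};
  sc_uM : {morph sc_u : x y / (x * y)%g >-> (x + y)%R};
  sc_ta : forall i j, sc_t i (sc_a j) = ((i == j)%:R)%R;
  sc_tz : forall i, sc_t i sc_z = 0%R;
  sc_ua : forall i, sc_u (sc_a i) = 0%R;
  sc_uz : sc_u sc_z = 1%R;
  sc_gen : forall S : P -> Prop, S 1%g ->
    (forall x y, S x -> S y -> S (x * y)%g) -> (forall x, S x -> S x^-1%g) ->
    S sc_z -> (forall i, S (sc_a i)) -> forall x, S x;
  sc_zC : forall x, commute sc_z x;
  sc_center : forall c, (forall x, commute c x) -> sc_u c = 0%R -> c = 1%g }.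

Section Exactness.
Import GroupScope.
Variables (P : groupType) (I : finType) (D : split_center P I).
Let z := sc_z D.
Let a := sc_a D.
Let t := sc_t D.
Let u := sc_u D.
Let uM : {morph u : x y / x * y >-> (x + y)%R} := sc_uM D.
Let tM i : {morph t i : x y / x * y >-> (x + y)%R} := sc_tM D i.
Let uz : u z = 1%R := sc_uz D.
Let ua i : u (a i) = 0%R := sc_ua D i.
Let tz i : t i z = 0%R := sc_tz D i.
Let ta i j : t i (a j) = ((i == j)%:R)%R := sc_ta D i j.
Implicit Types (x y : P) (v : I -> int) (e : int).

Lemma zpowC m x : expgz z m * x = x * expgz z m.
Proof. by apply/esym/expgz_commute/commute_sym/sc_zC. Qed.

Lemma u_zpow m : u (expgz z m) = m.
Proof. by rewrite additiveX // uz mulr1. Qed.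

Lemma centralE c : (forall x, commute c x) -> c = expgz z (u c).
Proof.
move=> cC; apply: divg1_eq; apply: (sc_center (s := D)); last first.
  by rewrite -/u uM additiveV // u_zpow subrr.
by move=> x; apply/commute_sym/commuteM;
  [|apply/commuteV]; apply/commute_sym => //; apply: zpowC.
Qed.

(** The homomorphism to int with value [v i] at the i-th generator and [e - 1] at z. *)
Definition transv_exp v e x : int := (\sum_i v i * t i x + (e - 1) * u x)%R.

Lemma transv_expM v e : {morph transv_exp v e : x y / x * y >-> (x + y)%R}.
Proof.
move=> x y; rewrite /transv_exp uM mulrDr addrACA; congr (_ + _)%R.
by rewrite -big_split; apply: eq_bigr => i _; rewrite tM mulrDr.
Qed.

Lemma transv_exp_z v e : transv_exp v e z = (e - 1)%R.
Proof.
by rewrite /transv_exp big1 => [|i _]; rewrite ?add0r ?uz ?mulr1 // tz mulr0.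
Qed.

Lemma transv_exp_a v e i : transv_exp v e (a i) = v i.
Proof.
rewrite /transv_exp (bigD1 i) //= big1 => [|j ji]; last by rewrite ta (negPf ji) mulr0.
by rewrite ua ta eqxx mulr0 mulr1 !addr0.
Qed.

Lemma additive_eq (f g : P -> int) :
  {morph f : x y / x * y >-> (x + y)%R} -> {morph g : x y / x * y >-> (x + y)%R} ->
  f z = g z -> (forall i, f (a i) = g (a i)) -> f =1 g.
Proof.
move=> fM gM fz fa x; apply: (sc_gen (s := D) (S := fun x => f x = g x)) => //.
- by rewrite !additive1.
- by move=> y y'; rewrite fM gM => -> ->.
- by move=> y; rewrite !additiveV // => ->.
Qed.

(** Since [transv_exp v e] is [e - 1] at z, this map raises z to the power [e]. *)
Definition transv v e x : P := x * expgz z (transv_exp v e x).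

Lemma transvM v e : {morph transv v e : x y / x * y}.
Proof.
by move=> x y; rewrite /transv transv_expM expgzD !mulgA; congr (_ * _);
   rewrite -!mulgA zpowC.
Qed.

(** The inner exponent is transported through z |-> z^e. This is where the
    semidirect product, rather than the direct one, appears. *)
Lemma transv_comp v e v' e' x :
  transv v e (transv v' e' x) = transv (fun i => v i + e * v' i)%R (e * e') x.
Proof.
rewrite /transv transv_expM (additiveX (@transv_expM v e)) transv_exp_z.
rewrite -mulgA -expgzD; congr (_ * expgz _ _).
transitivity (transv_exp v e x + e * transv_exp v' e' x)%R; first by ring.
rewrite /transv_exp mulrDr mulr_sumr addrACA -big_split /=; congr (_ + _)%R;
  last by ring.
by apply: eq_bigr => i _; ring.
Qed.

Lemma transv_id v e x : (forall i, v i = 0%R) -> e = 1%R -> transv v e x = x.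
Proof.
move=> v0 ->; rewrite /transv /transv_exp subrr mul0r big1 => [|i _];
  last by rewrite v0 mul0r.
by rewrite expgz0 mulg1.
Qed.

Lemma transv_aut v e : (e * e = 1)%R -> is_aut (transv v e).
Proof.
move=> ee; apply/asboolP; split; first exact: transvM.
exists (transv (fun i => - (e * v i))%R e) => x; rewrite transv_comp transv_id // => i;
  first ring.
by rewrite mulrN mulrA ee; ring.
Qed.

Lemma transv_inj v e v' e' : transv v e =1 transv v' e' -> v =1 v' /\ e = e'.
Proof.
move=> E; have T x : transv_exp v e x = transv_exp v' e' x.
  by have /(congr1 u) := E x; rewrite /transv !uM !u_zpow => /addrI.
split=> [i|]; first by rewrite -(transv_exp_a v e) T transv_exp_a.
by have := T z; rewrite !transv_exp_z => /addIr.
Qed.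

(** Modulo the center [f] is the identity, so [f x] is x times a power of z whose
    exponent is additive in x. As [f^-1] also preserves the center, [f] restricts to
    an automorphism of the infinite cyclic group generated by z, which leaves only
    the exponents 1 and -1. *)
Lemma natural_aut_kernel (f : group_aut P) : natural_aut f = 1 ->
  exists v e, (e = 1%R \/ e = (-1)%R) /\ f =1 transv v e.
Proof.
move=> f1; have fC x : exists2 c, f x = x * c & forall y, commute c y.
  have := natural_autE f x; rewrite f1 => /cq_piP[c /centerP cC ->].
  by exists c.
pose s x := (u (f x) - u x)%R.
have fE x : f x = x * expgz z (s x).
  rewrite /s; have [c -> /centralE cE] := fC x.
  by rewrite uM addrC addKr -cE.
have sM : {morph s : x y / x * y >-> (x + y)%R}.
  by move=> x y; rewrite /s autM !uM; ring.
exists (fun i => s (a i)), (1 + s z)%R; split; last first.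
  move=> x; rewrite fE /transv; congr (_ * expgz z _).
  apply: additive_eq => // [||i]; rewrite ?transv_exp_a //; first exact: transv_expM.
  by rewrite transv_exp_z addrAC subrr add0r.
have [g fK gK] := aut_bij f.
have zC : forall x, commute (g z) x.
  move=> x; apply: (bij_inj (aut_bij f)); rewrite !autM gK.
  exact: (sc_zC D).
have := fE z; rewrite -{2}[z]expgz1 -expgzD => fz.
(* z^m is the preimage of z with m = u (g z), so (1 + s z) m = 1 in int. *)
have /(congr1 u) : z = expgz z ((1 + s z) * u (g z))%R.
  rewrite -{1}[z]gK [in LHS](centralE zC) autX fz.
  suff X m k : expgz (expgz z m) k = expgz z (m * k)%R by rewrite X.
  rewrite [LHS]centralE ?additiveX // ?u_zpow ?[(k * m)%R]mulrC //;
    first by rewrite uz mulr1 mulrC.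
  by move=> x; apply/commute_sym/expgz_commute/commute_sym; apply: zpowC.
rewrite u_zpow uz [RHS]mulrC => /(congr1 absz); rewrite abszM => /esym/eqP.
by rewrite muln_eq1 => /andP[_ /eqP]; lia.
Qed.

(** P embeds in (P / Z) x int; equality of lifts is always checked through this. *)
Lemma proj_u_inj x y : cq_proj x = cq_proj y -> u x = u y -> x = y.
Proof.
move=> /cq_piP[c /centerP cC ->]; rewrite uM => E.
have c0 : u c = 0%R by lia.
by rewrite (sc_center (s := D) cC c0) mulg1.
Qed.

(** The inverse of the isomorphism from ker u to P / Z. *)
Definition null_section (y : central_quotient P) : P :=
  repr y * expgz z (- u (repr y))%R.

Lemma proj_zpow m : cq_proj (expgz z m) = 1.
Proof.
apply/esym/cq_piP; exists (expgz z m); last by rewrite mul1g.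
by apply/centerP => x; apply: zpowC.
Qed.

Lemma null_sectionK (y : central_quotient P) : cq_proj (null_section y) = y.
Proof. by rewrite cq_projM proj_zpow mulg1 /cq_proj reprK. Qed.

Lemma u_null_section (y : central_quotient P) : u (null_section y) = 0%R.
Proof. by rewrite uM u_zpow subrr. Qed.

(** On the direct product of ker u and the powers of z, this is phi on the first
    factor and the identity on the second. *)
Definition aut_lift (phi : group_aut (central_quotient P)) x : P :=
  null_section (phi (cq_proj x)) * expgz z (u x).

Lemma proj_aut_lift phi x : cq_proj (aut_lift phi x) = phi (cq_proj x).
Proof. by rewrite cq_projM proj_zpow mulg1 null_sectionK. Qed.

Lemma u_aut_lift phi x : u (aut_lift phi x) = u x.
Proof. by rewrite uM u_null_section u_zpow add0r. Qed.

Lemma aut_lift_aut phi : is_aut (aut_lift phi).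
Proof.
apply/asboolP; split.
  move=> x y; apply: proj_u_inj; first by rewrite cq_projM !proj_aut_lift cq_projM autM.
  by rewrite uM !u_aut_lift uM.
exists (aut_lift phi^-1) => x; apply: proj_u_inj; rewrite ?u_aut_lift // !proj_aut_lift.
  exact: autK.
exact: autVK.
Qed.

Lemma natural_aut_surj phi : exists f : group_aut P, natural_aut f = phi.
Proof.
exists (Defs.Aut (aut_lift_aut phi)); apply: autP => y.
by rewrite -[y]null_sectionK natural_autE; apply: proj_aut_lift.
Qed.

Local Notation Z2 := (Algebra.to_multiplicative 'Z_2).
Local Notation Zk := (Algebra.to_multiplicative 'rV[int]_#|I|).

(** The isomorphism of Z / 2 with the units of int. *)
Definition sgn2 (s : 'Z_2) : int := ((-1) ^+ (s : nat))%R.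

Lemma sgn2M (s s' : Z2) : sgn2 (s * s') = (sgn2 s * sgn2 s')%R.
Proof. by case: s s' => [[|[|]] //= i] [[|[|]] //= j]. Qed.
Lemma sgn2_sq s : (sgn2 s * sgn2 s = 1)%R.
Proof. by case: s => [[|[|]]]. Qed.
Lemma sgn2_inj : injective sgn2.
Proof. by move=> [[|[|]] //= i] [[|[|]] //= j] // _; apply: val_inj. Qed.

Definition sgn_act_fun (s : Z2) (v : Zk) : Zk := (sgn2 s *: (v : 'rV[int]_#|I|))%R.

Lemma sgn_act_aut s : is_aut (sgn_act_fun s).
Proof.
apply/asboolP; split; first by move=> v w; apply: scalerDr.
by exists (sgn_act_fun s) => v; rewrite /sgn_act_fun scalerA sgn2_sq scale1r.
Qed.

Lemma sgn_actM : {morph (fun s => Defs.Aut (sgn_act_aut s)) : s s' / s * s'}.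
Proof.
move=> s s'; apply: autP => v /=.
by rewrite /sgn_act_fun sgn2M scalerA.
Qed.

Definition sgn_act : {grouphom Z2 -> group_aut Zk} := hom_of sgn_actM.

Definition kernel_fun (x : semidirect sgn_act) : group_aut P :=
  Defs.Aut (transv_aut (fun i => (sd_k x : 'rV[int]_#|I|) ord0 (enum_rank i)) (sgn2_sq
    (sd_q x))).

Lemma kernel_funM : {morph kernel_fun : x y / x * y}.
Proof.
move=> x y; apply: autP => p /=; rewrite transv_comp sgn2M.
congr (transv _ _ _); apply: functional_extensionality_dep => i.
by rewrite !mxE.
Qed.

Definition kernel_hom : {grouphom semidirect sgn_act -> group_aut P} :=
  hom_of kernel_funM.

Theorem split_center_exact : short_exact kernel_hom (@natural_aut P).
Proof.
split; last exact: natural_aut_surj.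
- move=> [s v] [s' v'] /(congr1 (fun f : group_aut P => f : P -> P)) E.
  have /transv_inj[vv /sgn2_inj /= ->] : kernel_hom (Semidirect s v) =1 kernel_hom
    (Semidirect s' v').
    by rewrite E.
  congr Semidirect; apply/rowP => j; have := vv (enum_val j).
  by rewrite enum_valK.
move=> f; split=> [/natural_aut_kernel[v [e [eE fE]]] | [x <-]].
  have [s es] : exists s, e = sgn2 s.
    by case: eE => ->; [exists ord0 | exists (1%R : 'Z_2)].
  pose w : Zk := (\row_(j < #|I|) v (enum_val j))%R.
  exists (@Semidirect _ _ sgn_act (s : Z2) w).
  apply: autP => x; rewrite fE /= -es; congr (transv _ _ _).
  by apply: functional_extensionality_dep => i; rewrite mxE enum_rankK.
apply: autP => y; rewrite -[y]null_sectionK natural_autE /= cq_projM proj_zpow mulg1.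
by [].
Qed.

End Exactness.

Section Transport.
Import GroupScope.
Variables (P P' : groupType) (f : {grouphom P -> P'}) (I : finType).
Hypothesis f_bij : bijective f.

Lemma split_center_transport (D : split_center P I) :
  exists D' : split_center P' I, sc_z D' = f (sc_z D).
Proof.
have [g fK gK] := f_bij.
have gM : {morph g : x y / x * y} by move=> x y; apply: (can_inj fK);
  rewrite gmulfM !gK.
unshelve refine (ex_intro _ (@SplitCenter P' I (f (sc_z D)) (fun i => f (sc_a D i))
  (fun i x => sc_t D i (g x)) (fun x => sc_u D (g x)) _ _ _ _ _ _ _ _ _) erefl).
- by move=> i x y; rewrite gM sc_tM.
- by move=> x y; rewrite gM sc_uM.
- by move=> i j; rewrite fK sc_ta.
- by move=> i; rewrite fK sc_tz.
- by move=> i; rewrite fK sc_ua.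
- by rewrite fK sc_uz.
- move=> S S1 SM SV Sz Sa x; rewrite -[x]gK.
  apply: (sc_gen (s := D) (S := fun y => S (f y))) => //.
  + by rewrite gmulf1.
  + by move=> y z; rewrite gmulfM; apply: SM.
  + by move=> y; rewrite gmulfV; apply: SV.
- by move=> x; rewrite /commute -[x]gK -!gmulfM sc_zC.
- move=> c cC uc; rewrite -[c]gK (sc_center (s := D) _ uc) ?gmulf1 // => x.
  by apply: (can_inj fK); rewrite !gmulfM gK cC.
Qed.
End Transport.

(** * Centralizers in free groups *)

Definition no_rel (X : Type) : seq (X * bool) -> seq (X * bool) -> Prop :=
  fun _ _ => False.
Notation free_group X := (presented (@no_rel X)).

Section FreeGroup.
Import GroupScope.
Variable X : choiceType.
Implicit Types (l m : X * bool) (u v w : seq (X * bool)).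

Definition linv l := (l.1, ~~ l.2).

Lemma linvK : involutive linv.
Proof. by case=> x b; rewrite /linv /= negbK. Qed.

Definition reduced w := sorted (fun l m => m != linv l) w.

(** Left multiplication of a reduced word by a letter. *)
Definition push l w :=
  if w is m :: w' then if m == linv l then w' else l :: w else [:: l].

Lemma push_reduced l w : reduced w -> reduced (push l w).
Proof.
case: w => [|m w] //= mw; case: ifP => [_ | /negbT ml] /=; last by rewrite ml.
exact: path_sorted mw.
Qed.

Lemma pushK l w : reduced w -> push (linv l) (push l w) = w.
Proof.
case: w => [|m w] /=; first by rewrite linvK eqxx.
case: eqP => [-> | ml] /=; last by rewrite linvK eqxx.
by case: w => [|k w] //= /andP[/negPf->].
Qed.

Lemma foldr_push_reduced u w : reduced w -> reduced (foldr push w u).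
Proof. by move=> wr; elim: u => //= l u; apply: push_reduced. Qed.

(** Letters act on reduced words by permutations, inverse letters by inverse
    permutations; hence the free group acts, and the image of the empty word is a
    normal form. *)
Lemma foldr_push_cong u v : pres_cong (@no_rel X) u v ->
  forall w, reduced w -> foldr push w u = foldr push w v.
Proof.
elim=> {u v} //=.
- by move=> u v _ IH w wr; rewrite IH.
- by move=> v u w _ IH1 _ IH2 k kr; rewrite IH1 // IH2.
- move=> u u' v v' _ IH1 _ IH2 w wr; rewrite !foldr_cat IH2 // IH1 //.
  exact: foldr_push_reduced.
- by move=> x b w wr; have := pushK (linv (x, b)) wr; rewrite linvK.
Qed.

Lemma size_foldr_push u v : size (foldr push v u) <= size u + size v.
Proof.
elim: u => //= l u; case: (foldr push v u) => [|m w] //=.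
by case: ifP => /= _; lia.
Qed.

(** Each cancellation shortens the result, so a result of full length is the plain
    concatenation. *)
Lemma foldr_push_full u v :
  size (foldr push v u) = size u + size v -> foldr push v u = u ++ v.
Proof.
elim: u => //= l u; have := size_foldr_push u v.
case: (foldr push v u) => [|m w] /=.
  by move=> _ IH /eqP; rewrite eqSS => /eqP/IH <-.
by case: ifP => /= _ S IH E; [lia | rewrite -IH //; lia].
Qed.

Lemma push_cong l w : pres_cong (@no_rel X) (push l w) (l :: w).
Proof.
case: w => [|m w] /=; first exact: pres_cong_refl.
case: eqP => [-> | _]; last exact: pres_cong_refl.
case: l => x b; apply: pres_cong_sym.
exact: (pres_cong_cat (pres_cong_cancel _ x b) (pres_cong_refl _ w)).
Qed.

Lemma foldr_push_nf u : pres_cong (@no_rel X) (foldr push [::] u) u.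
Proof.
elim: u => [|l u IH]; first exact: pres_cong_refl.
apply: pres_cong_trans (push_cong _ _) _.
exact: (pres_cong_cat (pres_cong_refl _ [:: l]) IH).
Qed.

Lemma foldr_push_id u : reduced u -> foldr push [::] u = u.
Proof.
elim: u => //= l [|m u] IH // /andP[/negPf ml ru].
by rewrite IH //= ml.
Qed.

(** If the reduced word of c begins with a letter of a, choose a generator b other
    than a. Then b c is reduced as it stands, so c b has full length and is reduced
    too; but one begins with b and the other with a. *)
Lemma free_centerless (x y : X) (c : free_group X) :
  x != y -> (forall i, commute c (pgen _ i)) -> c = 1.
Proof.
move=> xy cC; set u := foldr push [::] (repr c).
have ur : reduced u by apply: foldr_push_reduced.
have cE : c = (\pi_(free_group X) u)%qT.
  by rewrite -[LHS]reprK; apply/pres_piP/pres_cong_sym/foldr_push_nf.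
case: u => [|l w] in ur cE *; first by rewrite cE.
have [b bl] : exists b, b != l.1.
  by have [-> | xl] := eqVneq l.1 x; [exists y; rewrite eq_sym | exists x;
    rewrite eq_sym].
have := cC b; rewrite /commute cE !pres_mulE => /pres_piP/foldr_push_cong.
move=> /(_ [::] isT); rewrite foldr_cat cat1s.
rewrite !foldr_push_id //; last first.
  by apply/andP; split=> //; apply: contraNneq bl => ->.
move=> E; have := E; rewrite foldr_push_full; last by rewrite E /= addn1.
by case=> lb; rewrite lb eqxx in bl.
Qed.
End FreeGroup.

(** * Generators of braid groups and the Artin action *)

Section BraidGenerators.
Import GroupScope.
Variable n : nat.

(** Indexing by nat, with the value 1 out of range, keeps the proofs of bounds out of
    the words below. *)
Definition half_twist (i : nat) : braid n :=
  oapp (fun j : 'I_n => pgen (@artin_rel n) j : braid n) 1 (insub i).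

Lemma half_twist_ord (j : 'I_n) : half_twist j = pgen (@artin_rel n) j.
Proof. by rewrite /half_twist valK. Qed.

Lemma half_twist_out i : n <= i -> half_twist i = 1.
Proof. by move=> ni; rewrite /half_twist insubN // -leqNgt. Qed.

Lemma half_twist_commute i j : i.+1 < j -> commute (half_twist i) (half_twist j).
Proof.
move=> ij; have [jn | /half_twist_out->] := ltnP j n; last exact: commute1.
have ltin : i < n by lia.
have := half_twist_ord (Ordinal ltin); have := half_twist_ord (Ordinal jn) => /= -> ->.
have := pres_relE (artin_comm (i := Ordinal ltin) (j := Ordinal jn) ij).
by rewrite /word_eval !big_cons !big_nil /= !mulg1.
Qed.

Lemma half_twist_braid i : i.+1 < n -> half_twist i * half_twist i.+1 * half_twist i =
  half_twist i.+1 * half_twist i * half_twist i.+1.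
Proof.
move=> jn; have ltin : i < n by lia.
have := half_twist_ord (Ordinal ltin); have := half_twist_ord (Ordinal jn) => /= -> ->.
have := pres_relE (artin_braid (i := Ordinal ltin) (j := Ordinal jn) erefl).
by rewrite /word_eval !big_cons !big_nil /= !mulg1 !mulgA.
Qed.

Lemma braid_ind (S : braid n -> Prop) :
  S 1 -> (forall x y, S x -> S y -> S (x * y)) ->
  (forall x, S x -> S x^-1) -> (forall i : 'I_n, S (half_twist i)) -> forall x, S x.
Proof.
by move=> S1 SM SV Sg; apply: presented_ind => // i; rewrite -half_twist_ord.
Qed.

Variables (H : groupType) (h : 'I_n -> H).
Hypothesis hC : forall i j : 'I_n, i.+1 < j -> h i * h j = h j * h i.
Hypothesis hB : forall i j : 'I_n, j = i.+1 :> nat ->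
  h i * h j * h i = h j * h i * h j.

Lemma braid_rel_hom u v : artin_rel u v -> word_eval h u = word_eval h v.
Proof.
case=> i j ij; rewrite /word_eval !big_cons !big_nil /= ?mulg1 ?mulgA.
  exact: hC.
exact: hB.
Qed.

Definition braid_hom : {grouphom braid n -> H} := pres_hom braid_rel_hom.

Lemma braid_homE (i : 'I_n) : braid_hom (half_twist i) = h i.
Proof. by rewrite half_twist_ord; apply: pres_homE. Qed.

End BraidGenerators.

Lemma eq_braid_hom n (H : groupType) (f g : {grouphom braid n -> H}) :
  (forall i : 'I_n, f (half_twist n i) = g (half_twist n i)) -> f =1 g.
Proof.
move=> fg; apply: braid_ind => [|x y Ex Ey|x Ex|//].
- by rewrite !gmulf1.
- by rewrite !gmulfM Ex Ey.
- by rewrite !gmulfV Ex.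
Qed.

Section FreeGenerators.
Import GroupScope.
Variable n : nat.

Definition fgen (i : nat) : free_group 'I_n :=
  oapp (fun j : 'I_n => pgen (@no_rel 'I_n) j) 1 (insub i).

Lemma fgen_ord (j : 'I_n) : fgen j = pgen (@no_rel 'I_n) j.
Proof. by rewrite /fgen valK. Qed.

Lemma fgen_out i : n <= i -> fgen i = 1.
Proof. by move=> ni; rewrite /fgen insubN // -leqNgt. Qed.

Lemma free_ind (S : free_group 'I_n -> Prop) :
  S 1 -> (forall x y, S x -> S y -> S (x * y)) ->
  (forall x, S x -> S x^-1) -> (forall i : 'I_n, S (fgen i)) -> forall x, S x.
Proof.
by move=> S1 SM SV Sg; apply: presented_ind => // i; rewrite -fgen_ord.
Qed.

Section Hom.
Variables (H : groupType) (h : nat -> H).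

Definition free_hom : {grouphom free_group 'I_n -> H} :=
  pres_hom (R := @no_rel 'I_n) (f := fun i : 'I_n => h i) (fun _ _ => False_rect _).

Lemma free_homE i : i < n -> free_hom (fgen i) = h i.
Proof.
by move=> lin; rewrite -[i]/(val (Ordinal lin)) fgen_ord; apply: pres_homE.
Qed.
End Hom.

End FreeGenerators.

Lemma eq_free_hom n (H : groupType) (f g : free_group 'I_n -> H) :
  {morph f : x y / (x * y)%g} -> {morph g : x y / (x * y)%g} ->
  (forall i : 'I_n, f (fgen n i) = g (fgen n i)) -> f =1 g.
Proof.
move=> fM gM fg; apply: free_ind => [|x y Ex Ey|x Ex|//].
- by rewrite !hom_of1.
- by rewrite fM gM Ex Ey.
- have V (k : free_group 'I_n -> H) (kM : {morph k : x y / (x * y)%g}) : k x^-1%g =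
  (k x)^-1%g.
    exact: (gmulfV (hom_of kM)).
  by rewrite !V ?Ex.
Qed.

Section ArtinAction.
Import GroupScope.
Variable p : nat.
Local Notation F := (free_group 'I_p.+1).
Local Notation x := (fgen p.+1).

(** The j-th half twist moves x_j to x_(j+1) and x_(j+1) to the conjugate that
    keeps the product x_j x_(j+1) fixed. *)
Definition artin_img j i : F :=
  if i == j then x j.+1 else if i == j.+1 then (x j.+1)^-1 * x j * x j.+1 else x i.
Definition artin_img_inv j i : F :=
  if i == j then x j * x j.+1 * (x j)^-1 else if i == j.+1 then x j else x i.

Lemma artin_imgL j : artin_img j j = x j.+1.
Proof. by rewrite /artin_img eqxx. Qed.
Lemma artin_imgR j : artin_img j j.+1 = (x j.+1)^-1 * x j * x j.+1.
Proof. by rewrite /artin_img eqxx gtn_eqF. Qed.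
Lemma artin_imgD j i : i <> j -> i <> j.+1 -> artin_img j i = x i.
Proof. by rewrite /artin_img => /eqP/negPf-> /eqP/negPf->. Qed.
Lemma artin_img_invL j : artin_img_inv j j = x j * x j.+1 * (x j)^-1.
Proof. by rewrite /artin_img_inv eqxx. Qed.
Lemma artin_img_invR j : artin_img_inv j j.+1 = x j.
Proof. by rewrite /artin_img_inv eqxx gtn_eqF. Qed.
Lemma artin_img_invD j i : i <> j -> i <> j.+1 -> artin_img_inv j i = x i.
Proof. by rewrite /artin_img_inv => /eqP/negPf-> /eqP/negPf->. Qed.

Lemma artin_imgK (j : 'I_p) :
  cancel (free_hom p.+1 (artin_img j)) (free_hom p.+1 (artin_img_inv j)) /\
  cancel (free_hom p.+1 (artin_img_inv j)) (free_hom p.+1 (artin_img j)).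
Proof.
have jp1 := ltn_ord j; have jp : j < p.+1 by apply: ltnW.
rewrite -ltnS in jp1; set f := free_hom _ _; set g := free_hom _ _.
have fE i : i < p.+1 -> f (x i) = artin_img j i := @free_homE _ _ _ i.
have gE i : i < p.+1 -> g (x i) = artin_img_inv j i := @free_homE _ _ _ i.
have idM : {morph @id F : x y / x * y} by [].
split; apply: eq_free_hom => // [y z|i]; rewrite ?gmulfM //.
  rewrite fE //; have [ij | nij] := eqVneq (i : nat) j.
    by rewrite ij artin_imgL gE // artin_img_invR.
  have [ij | nij'] := eqVneq (i : nat) j.+1.
    rewrite ij artin_imgR !gmulfM gmulfV !gE // artin_img_invL artin_img_invR.
    by rewrite !mulgA mulVg mul1g mulgVK.
  by rewrite artin_imgD ?gE ?artin_img_invD //; apply/eqP.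
rewrite gE //; have [ij | nij] := eqVneq (i : nat) j.
  rewrite ij artin_img_invL !gmulfM gmulfV !fE // artin_imgL artin_imgR.
  by rewrite !mulgA mulgV mul1g mulgK.
have [ij | nij'] := eqVneq (i : nat) j.+1.
  by rewrite ij artin_img_invR fE // artin_imgL.
by rewrite artin_img_invD ?fE ?artin_imgD //; apply/eqP.
Qed.

Lemma artin_gen_aut (j : 'I_p) : is_aut (free_hom p.+1 (artin_img j)).
Proof.
have [fK gK] := artin_imgK j; apply/asboolP; split; first exact: gmulfM.
by exists (free_hom p.+1 (artin_img_inv j)).
Qed.

Definition artin_gen j : group_aut F := Defs.Aut (artin_gen_aut j).

Lemma artin_genE (j : 'I_p) i : i < p.+1 -> artin_gen j (x i) = artin_img j i.
Proof. exact: free_homE. Qed.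

Lemma artin_genL (j : 'I_p) : artin_gen j (x j) = x j.+1.
Proof. by rewrite artin_genE ?artin_imgL // ltnW // ltnS. Qed.

Lemma artin_genR (j : 'I_p) : artin_gen j (x j.+1) = (x j.+1)^-1 * x j * x j.+1.
Proof. by rewrite artin_genE ?artin_imgR // ltnS. Qed.

Lemma artin_genD (j : 'I_p) (i : nat) : i <> j -> i <> j.+1 -> artin_gen j (x i) = x i.
Proof.
move=> ij ij'; have [ip | /fgen_out->] := ltnP i p.+1; last exact: sd_aut1.
by rewrite artin_genE ?artin_imgD.
Qed.

Lemma eq_free_aut (f g : group_aut F) :
  (forall i : nat, f (x i) = g (x i)) -> f = g.
Proof. by move=> fg; apply/autP/eq_free_hom => //; apply: autM. Qed.

Lemma artin_gen_commute (i j : 'I_p) : i.+1 < j ->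
  artin_gen i * artin_gen j = artin_gen j * artin_gen i.
Proof.
move=> ij; apply: eq_free_aut => k.
rewrite !aut_mulE.
have [-> | ki] := eqVneq k i.
  by rewrite artin_genD ?artin_genL ?artin_genD //; lia.
have [-> | ki'] := eqVneq k i.+1.
  rewrite artin_genD; try lia.
  by rewrite artin_genR !autM autV !artin_genD //; lia.
have [-> | kj] := eqVneq k j.
  by rewrite artin_genL ![artin_gen i _]artin_genD ?artin_genL //; lia.
have [-> | kj'] := eqVneq k j.+1.
  rewrite artin_genR [artin_gen i (x _)]artin_genD; try lia.
  by rewrite artin_genR !autM autV !artin_genD //; lia.
by rewrite !artin_genD //; lia.
Qed.

Lemma artin_gen_braid (i j : 'I_p) : j = i.+1 :> nat ->
  artin_gen i * artin_gen j * artin_gen i = artin_gen j * artin_gen i * artin_gen j.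
Proof.
move=> ji; apply: eq_free_aut => k.
rewrite !aut_mulE; have jL := artin_genL j; have jR := artin_genR j.
have iL := artin_genL i; have iR := artin_genR i.
have jD (l : nat) : l <> i.+1 -> l <> i.+2 -> artin_gen j (x l) = x l.
  by move=> *; apply: artin_genD; lia.
have iD (l : nat) : l <> i -> l <> i.+1 -> artin_gen i (x l) = x l.
  by move=> *; apply: artin_genD; lia.
rewrite ji in jL jR.
have [-> | k0] := eqVneq k i.
  by rewrite jD ?iL ?jL ?iD //; lia.
have [-> | k1] := eqVneq k i.+1.
  rewrite iR jL !autM !autV jL (iD i.+2) ?(jD i); try lia.
  by rewrite iL jR.
have [-> | k2] := eqVneq k i.+2.
  rewrite iD ?jR ?autM ?autV ?iL ?iR ?iD; try lia.
  rewrite !autM !autV jL jR jD; try lia.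
  by rewrite !invgM !invgK !mulgA !(mulgK, mulgVK).
by rewrite !(iD, jD) //; lia.
Qed.

Definition artin : {grouphom braid p -> group_aut F} :=
  braid_hom artin_gen_commute artin_gen_braid.

Lemma artinE (j : 'I_p) : artin (half_twist p j) = artin_gen j.
Proof. exact: braid_homE. Qed.

End ArtinAction.

(** * The boundary word and the full twist *)

Lemma aut_prod (G : groupType) (f : group_aut G) (m n : nat) (E : nat -> G) :
  (f (\prod_(m <= i < n) E i) = \prod_(m <= i < n) f (E i))%g.
Proof. exact: (gmulf_prod (hom_of (@autM _ f))). Qed.

Section BoundaryWord.
Import GroupScope.
Variable p : nat.
Local Notation F := (free_group 'I_p.+1).
Local Notation x := (fgen p.+1).

(** The class of a loop around all the punctures. *)
Definition boundary_word : F := \prod_(0 <= i < p.+1) x i.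

Lemma artin_gen_boundary (j : 'I_p) : artin_gen j boundary_word = boundary_word.
Proof.
have jp := ltn_ord j.
rewrite /boundary_word aut_prod !(big_cat_nat (m := 0) (n := j) (p := p.+1)) //;
  try lia.
rewrite !(big_cat_nat (m := j) (n := j.+2) (p := p.+1)) //; try lia.
congr (_ * (_ * _)).
- by apply: eq_big_nat => i ij; rewrite artin_genD //; lia.
- have two (E : nat -> F) : \prod_(j <= i < j.+2) E i = E j * E j.+1.
    by rewrite big_ltn // big_nat1.
  rewrite !two artin_genL artin_genR.
  by rewrite !mulgA mulgV mul1g.
- by apply: eq_big_nat => i ij; rewrite artin_genD //; lia.
Qed.

Lemma artin_boundary b : artin p b boundary_word = boundary_word.
Proof.
elim/braid_ind: b => [|b c Eb Ec|b Eb|i]; first by rewrite gmulf1.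
- by rewrite gmulfM aut_mulE Ec.
- by rewrite gmulfV -{1}Eb; apply: autK.
- by rewrite artinE artin_gen_boundary.
Qed.
End BoundaryWord.

Section Stair.
Import GroupScope.
Variable n : nat.

(** At k = n this is the braid delta that rotates all the punctures by one step, and
    delta ^ (n + 1) is the full twist. *)
Definition stair k : braid n := \prod_(0 <= i < k) half_twist n i.

Lemma stairS k : stair k.+1 = stair k * half_twist n k.
Proof. by rewrite /stair big_nat_recr. Qed.

Lemma half_twist_stair_commute i k : k < i -> commute (half_twist n i) (stair k).
Proof.
elim: k => [|k IH] ki; first by rewrite /stair big_geq //; apply: commute1.
rewrite stairS; apply: commuteM; first by apply: IH; lia.
by apply: commute_sym; apply: half_twist_commute.
Qed.

Lemma half_twist_stair j k : j.+1 < k -> k <= n -> half_twist n j.+1 * stair k =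
  stair k * half_twist n j.
Proof.
elim: k => // k IH jk kn; rewrite stairS; have [Ek | nk] := eqVneq k j.+1.
  rewrite Ek stairS !mulgA (half_twist_stair_commute (leqnn _)) -!mulgA; congr (_ * _).
  by rewrite !mulgA half_twist_braid // -Ek.
rewrite mulgA IH -?mulgA; try lia.
by rewrite (@half_twist_commute _ j k) //; lia.
Qed.
End Stair.

Section DeltaAction.
Import GroupScope.
Variable p : nat.
Local Notation x := (fgen p.+1).
Local Notation w := (boundary_word p).

Lemma artin_stair_gt k i : k <= p -> k < i -> artin p (stair p k) (x i) = x i.
Proof.
elim: k i => [|k IH] i kp ki; first by rewrite /stair big_geq // gmulf1.
rewrite stairS gmulfM aut_mulE (artinE (Ordinal kp)).
by rewrite artin_genD /= ?IH //; lia.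
Qed.

Lemma artin_stair_lt k i : k <= p -> i < k -> artin p (stair p k) (x i) = x i.+1.
Proof.
elim: k i => // k IH i kp ik.
rewrite stairS gmulfM aut_mulE (artinE (Ordinal kp)).
have [-> | nik] := eqVneq i k.
  by rewrite (artin_genL (Ordinal kp)) artin_stair_gt // ltnW.
by rewrite artin_genD /= ?IH //; lia.
Qed.

Lemma artin_deltaS i : i < p -> artin p (stair p p) (x i) = x i.+1.
Proof. by move=> ip; rewrite artin_stair_lt. Qed.

(** The other generators are shifted, and the boundary word is fixed: this determines
    the image of the last one. *)
Lemma artin_delta_last : artin p (stair p p) (x p) = w^-1 * x 0 * w.
Proof.
have := artin_boundary (stair p p); rewrite {1}/boundary_word aut_prod big_nat_recr //=.
rewrite (eq_big_nat _ _ (F2 := fun i => x i.+1)) => [E|i ip]; last exact: artin_deltaS.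
apply: (mulgI (\prod_(0 <= i < p) x i.+1)); rewrite E !mulgA.
have -> : w = x 0 * \prod_(0 <= i < p) x i.+1 by rewrite /boundary_word big_nat_recl.
by rewrite invgM !mulgA mulgV mul1g mulVg mul1g.
Qed.

Lemma artin_delta_exp j i : i + j <= p -> artin p (stair p p ^+ j) (x i) = x (i + j).
Proof.
elim: j i => [|j IH] i ij; first by rewrite gmulf1 addn0.
by rewrite expgSr gmulfM aut_mulE artin_deltaS ?IH ?addSnnS //; lia.
Qed.

(** The full rotation brings x_i back to itself after passing once through x_p,
    where it picks up the conjugation by w. *)
Lemma artin_full_twist k : artin p (stair p p ^+ p.+1) k = w^-1 * k * w.
Proof.
apply: (eq_free_hom (g := fun k => w^-1 * k * w) _ _ _ k) => [|y z|i];
  first exact: autM.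
  by rewrite !mulgA mulgK.
have ip : i <= p by rewrite -ltnS.
have -> : stair p p ^+ p.+1 = stair p p ^+ (i + (p - i).+1)%N by congr (_ ^+ _); lia.
rewrite expgnDr expgS !gmulfM !aut_mulE artin_delta_exp ?subnKC //.
rewrite artin_delta_last !autM autV artin_boundary.
by rewrite artin_delta_exp.
Qed.
End DeltaAction.

(** * Coset representatives for the last puncture *)

Section CosetWords.
Import GroupScope.
Variable p : nat.
Local Notation s := (half_twist p.+1).

(** The word sigma_p ... sigma_k, which carries the last puncture to position k. *)
Definition coset_rep k : braid p.+1 := \prod_(0 <= i < p.+1 - k) s (p - i).

Lemma coset_rep_last : coset_rep p.+1 = 1.
Proof. by rewrite /coset_rep subnn big_geq. Qed.

Lemma coset_repS k : k <= p -> coset_rep k = coset_rep k.+1 * s k.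
Proof.
move=> kp; rewrite /coset_rep subSn // big_nat_recr //= subKn //.
Qed.

(** Adapted to [coset_repS], which expresses each representative by the next one. *)
Lemma descending_ind (S : nat -> Prop) :
  S p.+1 -> (forall k, k <= p -> S k.+1 -> S k) -> forall k, k <= p.+1 -> S k.
Proof.
move=> S0 SS k kp; rewrite -(subKn kp); elim: (p.+1 - k) (leq_subr k p.+1) => [|j IH]
  jp.
  by rewrite subn0.
apply: SS; first lia.
by have -> : (p.+1 - j.+1).+1 = p.+1 - j; [lia | apply: IH; lia].
Qed.

Lemma coset_rep_commute i k : i.+1 < k -> k <= p.+1 -> commute (s i) (coset_rep k).
Proof.
move=> ik kp; elim/descending_ind: k / kp ik => [|k kp IH] ik.
  by rewrite coset_rep_last; apply: commute1.
by rewrite coset_repS //; apply: commuteM; [apply: IH; lia | apply: half_twist_commute].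
Qed.

Lemma coset_rep_shift i k : k <= i -> i < p -> coset_rep k * s i.+1 = s i * coset_rep k.
Proof.
move=> ki ip; have kp : k <= p.+1 by lia.
elim/descending_ind: k / kp ki => [|k kp IH] ki; first lia.
rewrite coset_repS //; have [ik | nik] := eqVneq i k; last first.
  by rewrite -mulgA (@half_twist_commute _ k i.+1) ?mulgA ?IH //; lia.
rewrite -{}ik in kp *; rewrite coset_repS // !mulgA (coset_rep_commute (k := i.+2)) //.
by rewrite -!mulgA; congr (_ * _); rewrite !mulgA half_twist_braid.
Qed.

(** The last strand makes a loop around the i-th one: this is a conjugate of the square
    of sigma_i. The definition is locked so that reassociating products does not open
    it. *)
Definition pure_gen : nat -> braid p.+1 := locked (fun i => coset_rep i * s i *
  (coset_rep i.+1)^-1).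

Lemma pure_gen_def i : pure_gen i = coset_rep i * s i * (coset_rep i.+1)^-1.
Proof. by rewrite /pure_gen; unlock. Qed.

Lemma pure_genE i : pure_gen i * coset_rep i.+1 = coset_rep i * s i.
Proof. by rewrite pure_gen_def mulgVK. Qed.

(** The next lemmas say that conjugation by the half twists of the first p + 1 strands
    acts on the elements [pure_gen i] by the formulas of the Artin action. *)
Lemma half_twist_pure_gen i j : j < p -> i != j -> i != j.+1 -> i <= p ->
  s j * pure_gen i = pure_gen i * s j.
Proof.
move=> jp ij ij' ip; have [ji | ij''] := ltnP j i.
  rewrite pure_gen_def; apply: commuteM; last by apply/commuteV/coset_rep_commute; lia.
  by apply: commuteM; [apply: coset_rep_commute | apply: half_twist_commute]; lia.
apply: (mulIg (coset_rep i.+1)).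
rewrite -!mulgA pure_genE -coset_rep_shift; try lia.
rewrite 2!mulgA pure_genE -coset_rep_shift; try lia.
by rewrite -!mulgA (@half_twist_commute _ i j.+1) //; lia.
Qed.

Lemma half_twist_pure_genL j : j < p -> s j * pure_gen j = pure_gen j.+1 * s j.
Proof.
move=> jp; apply: (mulIg (coset_rep j.+1)).
rewrite -mulgA pure_genE mulgA -coset_rep_shift // coset_repS 1?ltnW // -!mulgA [s j *
  (_ * s j)]mulgA half_twist_braid 1?ltnS //.
rewrite [in RHS]coset_repS // [s j * (_ * _)]mulgA (coset_rep_commute (k := j.+2)) //.
by rewrite !mulgA pure_genE.
Qed.

Lemma pure_gen_pairE j : pure_gen j * pure_gen j.+1 =
  coset_rep j * s j * s j.+1 * (coset_rep j.+2)^-1.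
Proof. by rewrite [pure_gen j.+1]pure_gen_def !mulgA pure_genE. Qed.

Lemma half_twist_pure_gen_pair j : j < p -> s j * (pure_gen j * pure_gen j.+1) =
  pure_gen j * pure_gen j.+1 * s j.
Proof.
move=> jp; rewrite pure_gen_pairE !mulgA -coset_rep_shift //;
  apply: (mulIg (coset_rep j.+2)).
rewrite mulgVK -[in RHS]mulgA (coset_rep_commute (k := j.+2)) // !mulgA mulgVK.
by rewrite -!mulgA; congr (_ * _); rewrite !mulgA half_twist_braid.
Qed.

(** Formal consequence of the action on [pure_gen j] and of the invariance of the
    product of two consecutive elements. *)
Lemma half_twist_pure_genR j : j < p -> s j * pure_gen j.+1 =
  (pure_gen j.+1)^-1 * pure_gen j * pure_gen j.+1 * s j.
Proof.
move=> jp; apply: (mulgI (pure_gen j.+1)); rewrite mulgA -half_twist_pure_genL //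
  -mulgA half_twist_pure_gen_pair //.
by rewrite !mulgA mulgV mul1g.
Qed.

(** The product telescopes. *)
Lemma prod_pure_gen k : \prod_(0 <= i < k) pure_gen i * coset_rep k =
  coset_rep 0 * stair p.+1 k.
Proof.
elim: k => [|k IH]; first by rewrite /stair !big_geq // mul1g mulg1.
by rewrite big_nat_recr //= -mulgA pure_genE mulgA IH -mulgA stairS.
Qed.

Lemma coset_rep_delta k : 0 < k -> k <= p.+1 -> coset_rep k * stair p.+1 p.+1 =
  stair p.+1 p * coset_rep k.-1.
Proof.
move=> k0 kp; elim/descending_ind: k / kp k0 => [|k kp IH] k0.
  by rewrite coset_rep_last mul1g stairS coset_repS // coset_rep_last mul1g.
case: k kp IH k0 => // k kp IH _.
by rewrite coset_repS // -mulgA half_twist_stair // mulgA IH //= -mulgA -coset_repS //;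
  lia.
Qed.

(** With one strand more, each factor delta leaves on the right one more letter of a
    coset representative. *)
Lemma delta_exp m : m <= p.+1 ->
  stair p.+1 p.+1 ^+ m = stair p.+1 p ^+ m * coset_rep (p.+1 - m).
Proof.
elim: m => [|m IH] mp; first by rewrite subn0 coset_rep_last mulg1.
rewrite expgSr IH; last by apply: ltnW.
rewrite [in RHS]expgSr -mulgA -[in RHS]mulgA.
congr (_ * _).
by rewrite coset_rep_delta; [congr (_ * coset_rep _); lia | lia | lia].
Qed.

Lemma full_twistS : stair p.+1 p.+1 ^+ p.+2 =
  stair p.+1 p ^+ p.+1 * \prod_(0 <= i < p.+1) pure_gen i.
Proof.
rewrite expgSr delta_exp // subnn -mulgA -prod_pure_gen coset_rep_last mulg1 //.
Qed.

End CosetWords.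

(** * Combing: the stabilizer of the last puncture *)

Section Semidirect.
Import GroupScope.
Variables (Q K : groupType) (act : {grouphom Q -> group_aut K}).
Implicit Types (q : Q) (k : K).

Definition sd_inq q : semidirect act := Semidirect q 1.
Definition sd_ink k : semidirect act := Semidirect 1 k.

Lemma sd_mulE (a b : semidirect act) :
  a * b = Semidirect (sd_q a * sd_q b) (sd_k a * act (sd_q a) (sd_k b)).
Proof. by []. Qed.

Lemma sd_inqM : {morph sd_inq : q r / q * r}.
Proof. by move=> q r; rewrite sd_mulE /= sd_aut1 mulg1. Qed.
Lemma sd_inkM : {morph sd_ink : k l / k * l}.
Proof. by move=> k l; rewrite sd_mulE /= mulg1 gmulf1. Qed.
Lemma sd_split (a : semidirect act) : a = sd_ink (sd_k a) * sd_inq (sd_q a).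
Proof. by case: a => q k; rewrite sd_mulE /= mul1g sd_aut1 mulg1. Qed.
Lemma sd_inq_ink q k : sd_inq q * sd_ink k = sd_ink (act q k) * sd_inq q.
Proof. by rewrite !sd_mulE /= mul1g mulg1 sd_aut1 mul1g mulg1. Qed.

Definition sd_inq_hom := hom_of sd_inqM.
Definition sd_ink_hom := hom_of sd_inkM.

Lemma sd_inqV : {morph sd_inq : q / q^-1}. Proof. exact: (gmulfV sd_inq_hom). Qed.
Lemma sd_inkV : {morph sd_ink : k / k^-1}. Proof. exact: (gmulfV sd_ink_hom). Qed.

Section FromSemidirect.
Variables (H : groupType) (f : {grouphom K -> H}) (g : {grouphom Q -> H}).
Hypothesis fg : forall q k, g q * f k = f (act q k) * g q.

Definition sd_ext_fun (a : semidirect act) := f (sd_k a) * g (sd_q a).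

Lemma sd_extM : {morph sd_ext_fun : a b / a * b}.
Proof.
move=> a b; rewrite /sd_ext_fun sd_mulE /= !gmulfM -!mulgA; congr (_ * _).
by rewrite !mulgA fg.
Qed.

Definition sd_ext : {grouphom semidirect act -> H} := hom_of sd_extM.
End FromSemidirect.
End Semidirect.

Section Combing.
Import GroupScope.
Variable p : nat.
Local Notation F := (free_group 'I_p.+1).
Local Notation x := (fgen p.+1).
Local Notation s := (half_twist p.+1).
Local Notation G := (semidirect (artin p)).

Lemma add_strand_commute (i j : 'I_p) : i.+1 < j -> s i * s j = s j * s i.
Proof. exact: half_twist_commute. Qed.
Lemma add_strand_braid (i j : 'I_p) : j = i.+1 :> nat -> s i * s j * s i =
  s j * s i * s j.
Proof. by move=> ji; have jp := ltn_ord j; rewrite ji half_twist_braid // -ji ltnW. Qed.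

Definition add_strand : {grouphom braid p -> braid p.+1} :=
  braid_hom add_strand_commute add_strand_braid.
Lemma add_strandE i : i < p -> add_strand (half_twist p i) = s i.
Proof. by move=> ip; rewrite (braid_homE _ _ (Ordinal ip)). Qed.

(** The point-pushing map: the last puncture is dragged along a loop that avoids the
    others. *)
Definition point_push : {grouphom F -> braid p.+1} := free_hom p.+1 (pure_gen p).
Lemma point_pushE i : i <= p -> point_push (x i) = pure_gen p i.
Proof. exact: (@free_homE p.+1 _ (pure_gen p)). Qed.

(** By induction it is enough to treat half twists and free generators, where this is
    the conjugation formula for [pure_gen]. *)
Lemma add_strand_push q k : add_strand q * point_push k =
  point_push (artin p q k) * add_strand q.
Proof.
elim/braid_ind: q k => [|q r IHq IHr|q IH|j] k.
- by rewrite !gmulf1 mulg1 mul1g.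
- by rewrite gmulfM -mulgA IHr mulgA IHq mulgA gmulfM.
- rewrite gmulfV; apply: (mulgI (add_strand q)); rewrite mulgA mulgV mul1g mulgA IH.
  have -> : artin p q (artin p q^-1 k) = k by rewrite gmulfV; apply: autVK.
  by rewrite mulgK.
have jp := ltn_ord j.
suff E : (fun k => point_push (artin_gen j k)) =1
         (fun k => add_strand (half_twist p j) * point_push k * (add_strand (half_twist
           p j))^-1).
  by rewrite artinE E mulgVK.
apply: eq_free_hom => [y z|y z|i].
- by rewrite autM gmulfM.
- by rewrite gmulfM !mulgA mulgVK.
have ip : i <= p by rewrite -ltnS.
rewrite add_strandE // point_pushE //; apply: (mulIg (s j)); rewrite mulgVK.
have [-> | nij] := eqVneq (i : nat) j.
  by rewrite artin_genL point_pushE // half_twist_pure_genL.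
have [-> | nij'] := eqVneq (i : nat) j.+1.
  by rewrite artin_genR !gmulfM gmulfV !point_pushE ?half_twist_pure_genR // ltnW.
by rewrite artin_genD ?point_pushE ?half_twist_pure_gen //; apply/eqP.
Qed.

Definition comb : {grouphom G -> braid p.+1} := sd_ext add_strand_push.

Lemma combE a : comb a = point_push (sd_k a) * add_strand (sd_q a).
Proof. by []. Qed.

Lemma add_strand_delta_exp m : add_strand (stair p p ^+ m) = stair p.+1 p ^+ m.
Proof.
rewrite gmulfXn; congr (_ ^+ _); rewrite /stair gmulf_prod.
by apply: eq_big_nat => i ip; rewrite add_strandE.
Qed.

(** Since w is fixed by the action, it commutes with the full twist on p + 1
    strands, which accounts for the order of the factors in [full_twistS]. *)
Lemma comb_full_twist : comb (Semidirect (stair p p ^+ p.+1) (boundary_word p)) =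
  stair p.+1 p.+1 ^+ p.+2.
Proof.
rewrite combE /= -{1}(artin_boundary (stair p p ^+ p.+1)) -add_strand_push
  add_strand_delta_exp full_twistS.
congr (_ * _); rewrite /boundary_word gmulf_prod.
by apply: eq_big_nat => i ip; rewrite point_pushE.
Qed.

Definition push_gen i : G := sd_ink (artin p) (x i).
Definition strand_gen i : G := sd_inq (artin p) (half_twist p i).

(** The element g such that, in the braid group,
    coset_rep k * sigma_i = comb g * coset_rep k', where k' is the image of k under the
    transposition of i and i + 1; see [coset_formula]. Only at k = i does the last
    strand make a full loop. A strand numbered above k loses one in its index when
    the k-th strand is put last. *)
Definition gen_cocycle (k i : nat) : G :=
  if k == i.+1 then 1 else if k == i then push_gen i
  else if i.+1 < k then strand_gen i else strand_gen i.-1.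

Lemma gen_cocycleS i : gen_cocycle i.+1 i = 1. Proof. by rewrite /gen_cocycle eqxx. Qed.
Lemma gen_cocycle_id i : gen_cocycle i i = push_gen i.
Proof. by rewrite /gen_cocycle eqxx ltn_eqF. Qed.
Lemma gen_cocycle_gt k i : i.+1 < k -> gen_cocycle k i = strand_gen i.
Proof. by move=> ik; rewrite /gen_cocycle ik !gtn_eqF // ltnW. Qed.
Lemma gen_cocycle_lt k i : k < i -> gen_cocycle k i = strand_gen i.-1.
Proof.
move=> ki; have E : (k == i.+1) = false by lia.
by have E' : (i.+1 < k) = false; [lia | rewrite /gen_cocycle E E' ltn_eqF].
Qed.

Lemma strand_gen_commute i j : i.+1 < j -> strand_gen i * strand_gen j =
  strand_gen j * strand_gen i.
Proof. by move=> ij; rewrite /strand_gen -!sd_inqM half_twist_commute. Qed.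
Lemma strand_gen_braid i : i.+1 < p -> strand_gen i * strand_gen i.+1 * strand_gen i =
  strand_gen i.+1 * strand_gen i * strand_gen i.+1.
Proof. by move=> ij; rewrite /strand_gen -!sd_inqM half_twist_braid. Qed.
Lemma strand_push_genL j : j < p -> strand_gen j * push_gen j =
  push_gen j.+1 * strand_gen j.
Proof.
by move=> jp; rewrite /strand_gen /push_gen sd_inq_ink (artinE (Ordinal jp)) (artin_genL
  (Ordinal jp)).
Qed.
Lemma strand_push_genR j : j < p -> strand_gen j * push_gen j.+1 =
  (push_gen j.+1)^-1 * push_gen j * push_gen j.+1 * strand_gen j.
Proof.
move=> jp; rewrite /strand_gen /push_gen sd_inq_ink (artinE (Ordinal jp)) (artin_genR
  (Ordinal jp)).
by rewrite !sd_inkM sd_inkV.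
Qed.
Lemma strand_push_gen_pair j : j < p -> strand_gen j * push_gen j * push_gen j.+1 =
  push_gen j * push_gen j.+1 * strand_gen j.
Proof.
by move=> jp; rewrite strand_push_genL // -mulgA strand_push_genR // !mulgA mulgV mul1g.
Qed.
Lemma strand_push_genD i j : j < p -> i <> j -> i <> j.+1 ->
  strand_gen j * push_gen i = push_gen i * strand_gen j.
Proof.
move=> jp ij ij'; rewrite /strand_gen /push_gen sd_inq_ink (artinE (Ordinal jp)).
by rewrite (artin_genD (j := Ordinal jp)).
Qed.

(** The permutation of a half twist, on nat to match [gen_cocycle]. *)
Definition adj_swap (i k : nat) : nat :=
  if k == i then i.+1 else if k == i.+1 then i else k.

Lemma adj_swapL i : adj_swap i i = i.+1. Proof. by rewrite /adj_swap eqxx. Qed.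
Lemma adj_swapR i : adj_swap i i.+1 = i. Proof. by rewrite /adj_swap eqxx gtn_eqF. Qed.
Lemma adj_swapD i k : k <> i -> k <> i.+1 -> adj_swap i k = k.
Proof. by rewrite /adj_swap => /eqP/negPf-> /eqP/negPf->. Qed.

Lemma adj_swapK i : involutive (adj_swap i).
Proof.
move=> k; have [-> | ki] := eqVneq k i; first by rewrite adj_swapL adj_swapR.
have [-> | ki'] := eqVneq k i.+1; first by rewrite adj_swapR adj_swapL.
by rewrite !adj_swapD //; apply/eqP.
Qed.

(** This lemma and the next say that the cocycle respects the braid relations, that is,
    that the representation induced from the stabilizer of the last puncture exists.
    They are read off from the action of half twists on the x_i, one case for each
    position of k relative to the indices. *)
Lemma gen_cocycle_commute i j k : i.+1 < j -> j <= p ->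
  gen_cocycle k i * gen_cocycle (adj_swap i k) j =
    gen_cocycle k j * gen_cocycle (adj_swap j k) i.
Proof.
move=> ij jp.
have [ki | ki | ->] := ltngtP k i.
- have kj : k < j by lia.
  rewrite (@adj_swapD i) ?(@adj_swapD j) ?(gen_cocycle_lt ki) ?(gen_cocycle_lt kj);
    try lia.
  by apply: strand_gen_commute; lia.
- have [ki' | ki' | ->] := ltngtP k i.+1; first lia; last first.
    by rewrite adj_swapR adj_swapD ?gen_cocycleS ?mul1g ?mulg1 ?(gen_cocycle_lt ij)
      ?gen_cocycle_lt //; lia.
  rewrite (@adj_swapD i) ?(gen_cocycle_gt ki'); try lia.
  have [kj | kj | ->] := ltngtP k j.
  + rewrite (@adj_swapD j) ?(gen_cocycle_lt kj) ?(gen_cocycle_gt ki'); try lia.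
    by apply: strand_gen_commute; lia.
  + have [kj' | kj' | ->] := ltngtP k j.+1; first lia; last first.
      by rewrite adj_swapR gen_cocycleS mul1g mulg1 gen_cocycle_gt.
    rewrite (@adj_swapD j) ?(gen_cocycle_gt kj') ?(gen_cocycle_gt ki'); try lia.
    by apply: strand_gen_commute; lia.
  + by rewrite adj_swapL gen_cocycle_id (@gen_cocycle_gt j.+1) ?strand_push_genD //;
    lia.
have ij' : i < j by lia.
rewrite adj_swapL gen_cocycle_id (@adj_swapD j) ?gen_cocycle_id ?(gen_cocycle_lt ij)
  ?(gen_cocycle_lt ij'); try lia.
by rewrite strand_push_genD //; lia.
Qed.

Lemma gen_cocycle_braid i k : i < p -> k <= p.+1 ->
  gen_cocycle k i * gen_cocycle (adj_swap i k) i.+1 * gen_cocycle (adj_swap i.+1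
    (adj_swap i k)) i =
  gen_cocycle k i.+1 * gen_cocycle (adj_swap i.+1 k) i * gen_cocycle (adj_swap i
    (adj_swap i.+1 k)) i.+1.
Proof.
move=> ip kp.
have [-> | k0] := eqVneq k i.
  rewrite (@adj_swapD i.+1 i) ?adj_swapL ?gen_cocycle_id ?(@gen_cocycle_gt i.+2 i)
    ?(@gen_cocycle_lt i i.+1) //; try lia.
  by rewrite strand_push_gen_pair.
have [-> | k1] := eqVneq k i.+1.
  rewrite adj_swapR !adj_swapL (@adj_swapD i.+1 i) ?(@adj_swapD i i.+2); try lia.
  rewrite !gen_cocycleS !gen_cocycle_id !mul1g (@gen_cocycle_gt i.+2 i)
    ?(@gen_cocycle_lt i i.+1) ?mulg1 //.
  exact: strand_push_genL.
have [-> | k2] := eqVneq k i.+2.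
  rewrite (@adj_swapD i i.+2) ?adj_swapR ?gen_cocycleS; try lia.
  by rewrite !mul1g !mulg1 (@gen_cocycle_gt i.+2 i) ?(@gen_cocycle_lt i i.+1).
rewrite !(@adj_swapD i k) ?(@adj_swapD i.+1 k) ?(@adj_swapD i k); try lia.
have [ki | ki] := ltnP k i.
  rewrite (@gen_cocycle_lt k i) ?(@gen_cocycle_lt k i.+1) //; last lia.
  by case: i ip ki {k0 k1 k2} => // i ip ki; rewrite strand_gen_braid.
have ki' : i.+2 < k by lia.
rewrite (@gen_cocycle_gt k i) ?(@gen_cocycle_gt k i.+1) // ?strand_gen_braid //; lia.
Qed.
End Combing.

(** * The action of the braid group on cosets *)

Section Wreath.
Import GroupScope.
Variables (G : groupType) (m : nat).
Local Notation K := {ffun 'I_m -> G}.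

(** With the product (q, k) = k q the multiplication rule [wreath_kM] becomes the
    cocycle rule for right actions. *)
Definition reindex_fun (s : 'S_m) (f : K) : K := [ffun k => f (s k)].

Lemma reindex_aut s : is_aut (reindex_fun s).
Proof.
apply/asboolP; split; first by move=> f g; apply/ffunP => k; rewrite !ffunE.
by exists (reindex_fun s^-1) => f; apply/ffunP => k; rewrite !ffunE (permK, permKV).
Qed.

Lemma reindexM : {morph (fun s => Defs.Aut (reindex_aut s)) : s t / s * t}.
Proof. by move=> s t; apply: autP => f; apply/ffunP => k; rewrite !ffunE permM. Qed.

Definition wreath_act : {grouphom 'S_m -> group_aut K} := hom_of reindexM.
Definition wreath := semidirect wreath_act.
HB.instance Definition _ := monoid.Group.on wreath.

Lemma wreath_actE s f k : wreath_act s f k = f (s k).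
Proof. by rewrite ffunE. Qed.

Lemma wreath_eq (a b : wreath) :
  sd_q a = sd_q b -> (forall k, sd_k a k = sd_k b k) -> a = b.
Proof. by case: a b => q f [r g] /= -> /ffunP->. Qed.

Lemma wreath_kM (a b : wreath) k : sd_k (a * b) k = sd_k a k * sd_k b (sd_q a k).
Proof. by rewrite sd_mulE ffunE wreath_actE. Qed.
End Wreath.

Section CosetAction.
Import GroupScope.
Variable p : nat.
Local Notation F := (free_group 'I_p.+1).
Local Notation s := (half_twist p.+1).
Local Notation G := (semidirect (artin p)).
Local Notation W := (wreath G p.+2).
Local Notation comb := (comb p).
Local Notation add_strand := (add_strand p).
Local Notation point_push := (point_push p).

Lemma adj_tpermE n (i : 'I_n) k : adj_tperm i k = adj_swap i k :> nat.
Proof.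
rewrite /adj_swap; case: eqP => [ki | ki].
  have -> : k = widen_ord (leqnSn n) i by apply: val_inj.
  by rewrite tpermL /= /bump /= add1n.
case: eqP => [ki' | ki'].
  have -> : k = lift ord0 i by apply: val_inj; rewrite /= /bump /= ki'.
  by rewrite tpermR.
by rewrite tpermD // -val_eqE /= ?/bump /= ?add1n; apply/eqP => E;
  [case: ki | case: ki'].
Qed.

Definition coset_wreath_gen (i : 'I_p.+1) : W :=
  Semidirect (adj_tperm i) [ffun k : 'I_p.+2 => gen_cocycle p k i].

Lemma coset_wreath_gen_q i : sd_q (coset_wreath_gen i) = adj_tperm i. Proof. by []. Qed.
Lemma coset_wreath_gen_k i k : sd_k (coset_wreath_gen i) k =
  gen_cocycle p k i. Proof. exact: ffunE. Qed.

Lemma coset_wreath_commute (i j : 'I_p.+1) : i.+1 < j ->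
  coset_wreath_gen i * coset_wreath_gen j = coset_wreath_gen j * coset_wreath_gen i.
Proof.
move=> ij; apply: wreath_eq => [|k].
  by have := artin_rel_perm (artin_comm ij);
    rewrite /word_eval !big_cons !big_nil /= !mulg1.
rewrite !wreath_kM !coset_wreath_gen_q !coset_wreath_gen_k !adj_tpermE
  gen_cocycle_commute //.
by have := ltn_ord j.
Qed.

Lemma coset_wreath_braid (i j : 'I_p.+1) : j = i.+1 :> nat ->
  coset_wreath_gen i * coset_wreath_gen j * coset_wreath_gen i =
    coset_wreath_gen j * coset_wreath_gen i * coset_wreath_gen j.
Proof.
move=> ji; apply: wreath_eq => [|k].
  by have := artin_rel_perm (artin_braid ji);
    rewrite /word_eval !big_cons !big_nil /= !mulg1 -!mulgA.
rewrite !wreath_kM /= !permM !ffunE !adj_tpermE ji gen_cocycle_braid //;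
  last by rewrite -ltnS.
by have := ltn_ord j; rewrite ji.
Qed.

Definition coset_wreath : {grouphom braid p.+1 -> W} :=
  braid_hom coset_wreath_commute coset_wreath_braid.

Lemma coset_wreathE (i : 'I_p.+1) : coset_wreath (s i) = coset_wreath_gen i.
Proof. exact: braid_homE. Qed.

Lemma braid_perm_half_twist n (i : 'I_n) : braid_perm (half_twist n i) = adj_tperm i.
Proof.
rewrite half_twist_ord /braid_perm pres_eval_pi; last exact: artin_rel_perm.
by rewrite /word_eval big_seq1.
Qed.

Lemma braid_permV n (b : braid n) : braid_perm b^-1 = (braid_perm b)^-1.
Proof. exact: gmulfV. Qed.

Lemma coset_wreath_q b : sd_q (coset_wreath b) = braid_perm b.
Proof.
elim/braid_ind: b => [|b c Eb Ec|b Eb|i].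
- by rewrite !gmulf1.
- by rewrite !gmulfM /= Eb Ec.
- by rewrite !gmulfV /= Eb.
- by rewrite coset_wreathE braid_perm_half_twist.
Qed.

Definition cocycle (b : braid p.+1) k : G := sd_k (coset_wreath b) k.

Lemma cocycleM b c k : cocycle (b * c) k = cocycle b k * cocycle c (braid_perm b k).
Proof. by rewrite /cocycle gmulfM wreath_kM coset_wreath_q. Qed.
Lemma cocycle1 k : cocycle 1 k = 1.
Proof. by rewrite /cocycle gmulf1 ffunE. Qed.

Lemma cocycle_half_twist (i : 'I_p.+1) k : cocycle (s i) k = gen_cocycle p k i.
Proof. by rewrite /cocycle coset_wreathE coset_wreath_gen_k. Qed.

Lemma comb_inq q : comb (sd_inq (artin p) q) = add_strand q.
Proof. by rewrite combE -[sd_k _]/(1 : F) gmulf1 mul1g. Qed.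
Lemma comb_ink k : comb (sd_ink (artin p) k) = point_push k.
Proof. by rewrite combE -[sd_q _]/(1 : braid p) gmulf1 mulg1. Qed.

(** The cocycle describes right multiplication on the cosets of the image of [comb].
    Both sides are multiplicative in b in the same way, so half twists suffice. *)
Lemma coset_formula b (k : 'I_p.+2) :
  coset_rep p k * b = comb (cocycle b k) * coset_rep p (braid_perm b k).
Proof.
elim/braid_ind: b k => [|b c Eb Ec|b Eb|i] k.
- by rewrite cocycle1 !gmulf1 perm1 mulg1 mul1g.
- by rewrite mulgA Eb -mulgA Ec mulgA cocycleM gmulfM braid_permM permM.
- apply: (mulIg b); rewrite mulgVK -mulgA Eb mulgA -gmulfM -cocycleM mulVg cocycle1
  gmulf1.
  by rewrite -permM -braid_permM mulVg gmulf1 perm1 mul1g.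
rewrite cocycle_half_twist braid_perm_half_twist adj_tpermE.
have ip : i <= p by rewrite -ltnS.
have kp : k <= p.+1 by rewrite -ltnS.
have [-> | k1] := eqVneq (k : nat) i.+1.
  by rewrite gen_cocycleS adj_swapR gmulf1 mul1g [RHS]coset_repS.
have [-> | k0] := eqVneq (k : nat) i.
  by rewrite gen_cocycle_id adj_swapL comb_ink point_pushE // pure_genE.
rewrite adj_swapD; try by apply/eqP.
have [ki | ki] := ltnP k i.
  rewrite gen_cocycle_lt // comb_inq add_strandE; last lia.
  by rewrite -{1}(ltn_predK ki) coset_rep_shift //; lia.
have ki' : i.+1 < k by lia.
by rewrite gen_cocycle_gt // comb_inq add_strandE ?coset_rep_commute //; lia.
Qed.

(** The coset formula for the trivial coset: [comb] is onto the stabilizer of the last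
    puncture. *)
Lemma pure_comb b : braid_perm b ord_max = ord_max -> b = comb (cocycle b ord_max).
Proof. by move=> bm; have := coset_formula b ord_max;
  rewrite bm /= coset_rep_last mul1g mulg1. Qed.

Lemma cocycle_coset_rep (k : 'I_p.+2) : braid_perm (coset_rep p k) ord_max =
  k /\ cocycle (coset_rep p k) ord_max = 1.
Proof.
case: k => k kp /=; have kp' : k <= p.+1 by [].
suff H : forall j, j <= p.+1 ->
    braid_perm (coset_rep p j) ord_max = j :> nat /\ cocycle (coset_rep p j) ord_max =
      1.
  by have [E ->] := H k kp'; split=> //; apply: ord_inj.
apply: descending_ind => [|j jp [Ej Cj]]; first by rewrite coset_rep_last gmulf1 perm1
  cocycle1.
have jp1 : j < p.+1 by [].
rewrite coset_repS // cocycleM braid_permM permM Cj mul1g.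
rewrite -[j]/(val (Ordinal jp1)) cocycle_half_twist braid_perm_half_twist adj_tpermE.
by rewrite Ej /= adj_swapR gen_cocycleS.
Qed.

Lemma braid_perm_add_strand q (k : 'I_p.+1) :
  braid_perm (add_strand q) (widen_ord (leqnSn _) k) =
    widen_ord (leqnSn _) (braid_perm q k)
  /\ braid_perm (add_strand q) ord_max = ord_max.
Proof.
elim/braid_ind: q k => [|q r Eq Er|q Eq|i] k.
- by rewrite !gmulf1 !perm1.
- by rewrite !gmulfM !permM (Eq k).1 (Eq k).2 (Er _).1 (Er k).2.
- rewrite !gmulfV; split; apply: (@perm_inj _ (braid_perm (add_strand q)));
  rewrite permKV.
    by rewrite (Eq _).1 permKV.
  by rewrite (Eq k).2.
have ip := ltn_ord i.
have E : add_strand (half_twist p i) = s (widen_ord (leqnSn _) i) by rewrite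
  add_strandE.
split; apply: ord_inj; rewrite E !braid_perm_half_twist !adj_tpermE /= ?adj_tpermE //.
by rewrite adj_swapD //; lia.
Qed.

Lemma braid_perm_push k : braid_perm (point_push k) = 1.
Proof.
elim/free_ind: k => [|k l Ek El|k Ek|i]; first by rewrite !gmulf1.
- by rewrite gmulfM braid_permM Ek El mulg1.
- by rewrite gmulfV braid_permV Ek invg1.
have ip : i <= p by rewrite -ltnS.
rewrite point_pushE // pure_gen_def coset_repS // !braid_permM braid_permV -[i :
  nat]/(val i) braid_perm_half_twist.
by rewrite -(mulgA _ (adj_tperm i) (adj_tperm i)) [adj_tperm i * _]tperm2 mulg1 mulgV.
Qed.
End CosetAction.

(** * Pure braid groups as semidirect products *)

Section PureCombing.
Import GroupScope.
Variable p : nat.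
Local Notation F := (free_group 'I_p.+1).
Local Notation G := (semidirect (artin p)).
Local Notation comb := (comb p).
Local Notation add_strand := (add_strand p).
Local Notation point_push := (point_push p).

Lemma pureP n (b : braid n) : reflect (braid_perm b = 1) (is_pure b).
Proof.
apply: (iffP forallP) => [bP|-> k]; last by rewrite perm1.
by apply/permP=> k; rewrite perm1; apply/eqP.
Qed.

Lemma braid_perm_comb a : braid_perm (comb a) = braid_perm (add_strand (sd_q a)).
Proof. by rewrite combE braid_permM braid_perm_push mul1g. Qed.

Lemma comb_last a : braid_perm (comb a) ord_max = ord_max.
Proof. by rewrite braid_perm_comb; case: (braid_perm_add_strand (sd_q a) ord0). Qed.

Lemma pure_add_strand q : is_pure (add_strand q) = is_pure q.
Proof.
apply/forallP/forallP => H k; last first.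
  have [k' -> | ->] := unliftP ord_max k; last by rewrite (braid_perm_add_strand q
    ord0).2.
  have -> : lift ord_max k' = widen_ord (leqnSn _) k'.
    by apply: ord_inj; rewrite lift_max.
  by rewrite (braid_perm_add_strand q k').1 (eqP (H k')).
have := H (widen_ord (leqnSn _) k); rewrite (braid_perm_add_strand q k).1 => /eqP E.
by apply/eqP/ord_inj; have := congr1 (fun i : 'I_ _ => i : nat) E.
Qed.

(** On the stabilizer of the last puncture the cocycle is a homomorphism, so it is
    enough to compare with the identity on generators. This gives the injectivity
    of [comb]. *)
Lemma cocycle_comb a : cocycle (comb a) ord_max = a.
Proof.
have M : {morph (fun a => cocycle (comb a) ord_max) : a b / a * b}.
  by move=> b c; rewrite gmulfM cocycleM comb_last.
rewrite [in RHS](sd_split a) {1}(sd_split a) M; congr (_ * _).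
  have f1M : {morph (fun k => cocycle (comb (sd_ink (artin p) k)) ord_max) : k l / k * l}.
    by move=> k l; rewrite sd_inkM M.
  apply: (eq_free_hom f1M (@sd_inkM _ _ _)) => i; have ip : i <= p by rewrite -ltnS.
  rewrite comb_ink point_pushE //.
  have [_ C1] := cocycle_coset_rep (@Ordinal p.+2 i.+1 (ltn_ord i)).
  have [E0 C0] := cocycle_coset_rep (@Ordinal p.+2 i (ltnW (ltn_ord i))).
  have Ap : braid_perm (pure_gen p i) = 1 by rewrite -point_pushE // braid_perm_push.
  have := congr1 (fun b => cocycle b ord_max) (pure_genE p i).
  by rewrite !cocycleM Ap perm1 C1 mulg1 C0 mul1g E0 cocycle_half_twist /=
    gen_cocycle_id.
have f2M : {morph (fun q => cocycle (comb (sd_inq (artin p) q)) ord_max) : q r / q * r}.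
  by move=> q r; rewrite sd_inqM M.
apply: (eq_braid_hom (f := hom_of f2M) (g := sd_inq_hom (artin p))) => i.
have ip := ltn_ord i.
change (cocycle (comb (sd_inq (artin p) (half_twist p i))) ord_max = strand_gen p i).
rewrite comb_inq add_strandE //.
by rewrite (cocycle_half_twist (widen_ord (leqnSn _) i)) gen_cocycle_gt.
Qed.

Definition pure_act_fun (q : pure_braid p) : group_aut F := artin p (pure_val q).
Lemma pure_actM : {morph pure_act_fun : q r / q * r}.
Proof. by move=> q r; rewrite /pure_act_fun -gmulfM. Qed.
Definition pure_act : {grouphom pure_braid p -> group_aut F} := hom_of pure_actM.
Lemma pure_actE q : pure_act q = artin p (pure_val q). Proof. by []. Qed.

Definition forget_pure (a : semidirect pure_act) : G :=
  Semidirect (pure_val (sd_q a)) (sd_k a).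

Lemma forget_pureM : {morph forget_pure : a b / a * b}.
Proof. by []. Qed.

Lemma pure_comb_proof a : is_pure (comb (forget_pure a)).
Proof.
apply/pureP; rewrite braid_perm_comb; apply/pureP.
by rewrite pure_add_strand; apply: (valP (sd_q a)).
Qed.

Definition pure_comb_fun a : pure_braid p.+1 := PureBraid (pure_comb_proof a).

Lemma pure_comb_funM : {morph pure_comb_fun : a b / a * b}.
Proof.
move=> a b; apply: val_inj; rewrite valM.
rewrite -[LHS]/(comb (forget_pure (a * b))) forget_pureM.
by rewrite gmulfM.
Qed.

Lemma pure_comb_fun_bij : bijective pure_comb_fun.
Proof.
have P (b : pure_braid p.+1) : is_pure (sd_q (cocycle (pure_val b) ord_max)).
  case: b => b /= /[dup] bP /pureP b1.
  rewrite -pure_add_strand; apply/pureP; rewrite -braid_perm_comb -pure_comb //.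
  by rewrite b1 perm1.
exists (fun b => Semidirect (PureBraid (P b)) (sd_k (cocycle (pure_val b) ord_max))).
  case=> q k; have E := cocycle_comb (Semidirect (pure_val q) k).
  congr Semidirect; last exact: (congr1 (@sd_k _ _ _) E).
  by apply: val_inj; apply: (congr1 (@sd_q _ _ _) E).
move=> b; apply: val_inj; have /pureP b1 := valP b.
rewrite [RHS]pure_comb ?b1 ?perm1 //; congr comb.
Qed.
End PureCombing.

(** * Exponent sums *)

Section ExponentSums.
Import GroupScope.
Variable p : nat.
Local Notation F := (free_group 'I_p.+1).
Local Notation x := (fgen p.+1).

(** The total exponent of x_i in k. *)
Definition exp_sum (i : nat) (k : F) : int :=
  free_hom p.+1 (H := Algebra.to_multiplicative int)
    (fun j => ((i == j)%:R : int)%R) k.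

Lemma exp_sumM i : {morph exp_sum i : k l / k * l >-> (k + l)%R}.
Proof. by move=> k l; rewrite /exp_sum gmulfM. Qed.

Lemma exp_sumE i j : j < p.+1 -> exp_sum i (x j) = ((i == j)%:R)%R.
Proof. exact: (@free_homE p.+1 (Algebra.to_multiplicative int)). Qed.

Lemma exp_sum1 i : exp_sum i 1 = 0%R.
Proof. exact: additive1 (@exp_sumM i). Qed.
Lemma exp_sumV i k : exp_sum i k^-1 = (- exp_sum i k)%R.
Proof. exact: additiveV (@exp_sumM i) _. Qed.

Lemma exp_sum_boundary i : i < p.+1 -> exp_sum i (boundary_word p) = 1%R.
Proof.
move=> ip; rewrite /boundary_word.
have -> m : exp_sum i (\prod_(0 <= j < m) x j) = (\sum_(0 <= j < m) exp_sum i (x j))%R.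
  elim: m => [|m IH]; first by rewrite !big_geq // exp_sum1.
  by rewrite !big_nat_recr //= exp_sumM IH.
rewrite (eq_big_nat _ _ (F2 := fun j => ((i == j)%:R)%R)) => [|j jp];
  last exact: exp_sumE.
rewrite big_mkord (bigD1 (Ordinal ip)) //= eqxx big1 ?addr0 // => j.
by rewrite -val_eqE /= eq_sym => /negPf->.
Qed.

(** The Artin action sends each x_i to a conjugate of the generator prescribed by the
    permutation of the braid; exponent sums do not see the conjugation. *)
Lemma exp_sum_artin b (i : 'I_p.+1) k : exp_sum i (artin p b k) =
  exp_sum (braid_perm b i) k.
Proof.
elim/braid_ind: b i k => [|b c Eb Ec|b Eb|j] i k.
- by rewrite !gmulf1 perm1.
- by rewrite gmulfM aut_mulE Eb Ec braid_permM permM.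
- have -> : artin p b^-1 = (artin p b)^-1 by rewrite gmulfV.
  have := Eb ((braid_perm b)^-1 i) ((artin p b)^-1 k).
  by rewrite autVK permKV braid_permV => ->.
rewrite artinE braid_perm_half_twist adj_tpermE.
have ip := ltn_ord i; have jp : j.+1 < p.+1 by rewrite ltnS.
elim/free_ind: k => [|k l Ek El|k Ek|l].
- by rewrite sd_aut1 !exp_sum1.
- by rewrite autM !exp_sumM Ek El.
- by rewrite autV !exp_sumV Ek.
have lp := ltn_ord l; have swpl : (adj_swap j i == l) = (i == adj_swap j l :> nat).
  by rewrite -[in RHS](inj_eq (inv_inj (adj_swapK j))) adj_swapK.
rewrite [RHS]exp_sumE // {}swpl.
have [-> | lj] := eqVneq (l : nat) j.
  by rewrite artin_genL exp_sumE // adj_swapL.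
have [-> | lj'] := eqVneq (l : nat) j.+1.
  rewrite artin_genR exp_sumM exp_sumM exp_sumV addrAC addNr add0r adj_swapR.
  by apply: exp_sumE; apply: ltnW.
by rewrite adj_swapD ?artin_genD ?exp_sumE //; apply/eqP.
Qed.

Lemma exp_sum_pure q (i : 'I_p.+1) k : exp_sum i (pure_act p q k) = exp_sum i k.
Proof.
rewrite pure_actE exp_sum_artin; have /pureP -> := valP q.
by rewrite perm1.
Qed.
End ExponentSums.

(** * The center of the pure braid group *)

Section Step.
Import GroupScope.
Variable p : nat.
Local Notation x := (fgen p.+1).
Local Notation Q := (pure_braid p).
Local Notation G := (semidirect (pure_act p)).
Local Notation w := (boundary_word p).

(** z acts on the free group as conjugation by w^-1, which multiplication by w undoes;
    and w is fixed by all braids. *)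
Lemma full_twist_central (z : Q) : (forall q, commute z q) ->
  pure_val z = stair p p ^+ p.+1 -> forall a : G, commute (Semidirect z w : G) a.
Proof.
move=> zC zE [q k]; rewrite /commute !sd_mulE /= zC; congr Semidirect.
rewrite /pure_act_fun artin_boundary zE artin_full_twist.
by rewrite !mulgA mulgV mul1g.
Qed.

Lemma pure_comb_full_twist (z : Q) : pure_val z = stair p p ^+ p.+1 ->
  pure_val (pure_comb_fun (Semidirect z w : G)) = stair p.+1 p.+1 ^+ p.+2.
Proof. by move=> zE; rewrite -comb_full_twist -zE. Qed.

Section Extend.
Variables (I : finType) (D : split_center Q I).
Hypothesis zE : pure_val (sc_z D) = stair p p ^+ p.+1.
Hypothesis p_gt0 : 0 < p.
Let z' : G := Semidirect (sc_z D) w.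
Let a' (i : 'I_p.+1 + I) : G :=
  match i with inl i => sd_ink _ (x i) | inr i => sd_inq _ (sc_a D i) end.
(* w has exponent sum 1 in every x_i and u is 1 at z, so that the difference vanishes
   at w z. *)
Let t' (i : 'I_p.+1 + I) (g : G) : int :=
  match i with
  | inl i => (exp_sum i (sd_k g) - sc_u D (sd_q g))%R
  | inr i => sc_t D i (sd_q g)
  end.
Let u' (g : G) : int := sc_u D (sd_q g).

Lemma split_center_extend : exists D' : split_center G ('I_p.+1 + I)%type,
  sc_z D' = Semidirect (sc_z D) w.
Proof.
unshelve refine (ex_intro _ (@SplitCenter G _ z' a' t' u' _ _ _ _ _ _ _ _ _) erefl).
- case=> i g h; rewrite sd_mulE /=; last exact: sc_tM.
  by rewrite sc_uM exp_sumM exp_sum_pure; ring.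
- by move=> g h; apply: sc_uM.
- case=> i [j|j] /=.
  + by rewrite exp_sumE // (additive1 (sc_uM D)) subr0.
  + by rewrite exp_sum1 sc_ua subr0.
  + by rewrite (additive1 (sc_tM D i)).
  + by rewrite sc_ta.
- by case=> i /=; [rewrite exp_sum_boundary // sc_uz subrr | rewrite sc_tz].
- by case=> i; rewrite /u' /= ?(additive1 (sc_uM D)) ?sc_ua.
- by rewrite /u' /= sc_uz.
- move=> S S1 SM SV Sz Sa g.
  have Sr k : S (sd_ink _ k).
    elim/free_ind: k => [|k l Sk Sl|k Sk|i] //; last exact: (Sa (inl i)).
      by rewrite sd_inkM; apply: SM.
    by rewrite sd_inkV; apply: SV.
  rewrite [g]sd_split; apply: (SM) => //.
  apply: (sc_gen (s := D) (S := fun q => S (sd_inq _ q))) => //.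
  + by move=> q r; rewrite sd_inqM; apply: SM.
  + by move=> q; rewrite sd_inqV; apply: SV.
  + have -> : sd_inq (pure_act p) (sc_z D) = (sd_ink _ w)^-1 * z'.
      by rewrite [z']sd_split /= mulgA mulVg mul1g.
    by apply: SM => //; apply: SV; apply: Sr.
  + by move=> i; apply: (Sa (inr i)).
- by apply: full_twist_central => //; apply: sc_zC.
move=> c cC uc; have q1 : sd_q c = 1.
  apply: (sc_center (s := D)) => // q.
  exact: (congr1 (@sd_q _ _ _) (cC (sd_inq _ q))).
have ck : c = sd_ink _ (sd_k c).
  by rewrite {1}[c]sd_split q1 sd_mulE /= mul1g sd_aut1 mulg1.
rewrite ck; suff -> : sd_k c = 1 by [].
have p1 : 1 < p.+1 by [].
apply: (free_centerless (x := ord0) (y := Ordinal p1)) => // i.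
have := cC (sd_ink _ (x i)); rewrite {1 2}ck /commute -!sd_inkM => /(congr1 (@sd_k _ _ _)).
by rewrite /= fgen_ord.
Qed.
End Extend.
End Step.

Lemma braid0_trivial (b : braid 0) : b = 1%g.
Proof.
by elim/braid_ind: b => [|b c -> ->|b ->|[]] //; rewrite ?mulg1 ?invg1.
Qed.

Section Base.
Import GroupScope.
Local Notation F := (free_group 'I_1).
Local Notation x := (fgen 1).
Local Notation Q := (pure_braid 0).
Local Notation G := (semidirect (pure_act 0)).

Lemma free1E (k : F) : k = expgz (x 0) (exp_sum 0 k).
Proof.
elim/free_ind: k => [|k l Ek El|k Ek|[[] // i]]; first by rewrite exp_sum1.
- by rewrite exp_sumM expgzD -Ek -El.
- by rewrite exp_sumV expgzN -Ek.
by rewrite exp_sumE.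
Qed.

Lemma pure0_trivial (q : Q) : q = 1.
Proof. by apply: val_inj; rewrite [LHS]braid0_trivial [RHS]braid0_trivial. Qed.

(** On two strands the group is infinite cyclic and the full twist is its generator. The
    induction cannot start from the trivial group on one strand, where no
    homomorphism to int takes the value 1. *)
Lemma split_center_base : exists D : split_center G 'I_0,
  sc_z D = Semidirect 1 (boundary_word 0).
Proof.
pose u (g : G) : int := exp_sum 0 (sd_k g).
have w0 : boundary_word 0 = x 0 by rewrite /boundary_word big_nat1.
have uM : {morph u : g h / g * h >-> (g + h)%R}.
  by move=> g h; rewrite /u /= exp_sumM (exp_sum_pure _ ord0).
unshelve refine (ex_intro _ (@SplitCenter G 'I_0 (Semidirect 1 (boundary_word 0) :
  G) (fun _ => 1)
  (fun _ _ => 0%R) u _ _ _ _ _ _ _ _ _) erefl) => //.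
- by case.
- by case.
- by rewrite /u /= exp_sum_boundary.
- move=> S S1 SM SV Sz _ g.
  have -> : g = sd_ink _ (expgz (x 0) (u g)).
    by rewrite -free1E {1}[g]sd_split [sd_q g]pure0_trivial [sd_inq _ _]/(1 : G) mulg1.
  have Sn n : S (sd_ink _ (x 0 ^+ n)).
    elim: n => [|n IH] //; rewrite expgS sd_inkM; apply: SM => //.
    by rewrite -w0.
  by case: (u g) => n //=; rewrite sd_inkV; apply: SV.
- apply: full_twist_central => [q|]; first exact: commute_sym (commute1 _).
  by rewrite [LHS]braid0_trivial [RHS]braid0_trivial.
move=> c _ uc; rewrite [c]sd_split [sd_q c]pure0_trivial.
by rewrite [sd_k c]free1E -/(u c) uc expgz0 sd_mulE /= !mul1g sd_aut1.
Qed.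
End Base.

(** The full twist is carried along explicitly, since the induction step uses its action
    on the free group. *)
Lemma pure_braid_split_center p : 0 < p ->
  exists (I : finType) (D : split_center (pure_braid p) I),
    #|I|.+1 = 'C(p.+1, 2) /\ pure_val (sc_z D) = (stair p p ^+ p.+1)%g.
Proof.
case: p => // p _; elim: p => [|p [I [D [cI zE]]]].
  have [D zE] := split_center_base.
  have [D' zE'] := split_center_transport (f :=
    hom_of (@pure_comb_funM 0)) (@pure_comb_fun_bij 0) D.
  exists 'I_0, D'; rewrite card_ord; split=> //.
  rewrite zE' zE; apply: pure_comb_full_twist.
  by rewrite [LHS]braid0_trivial [RHS]braid0_trivial.
have [D1 zE1] := split_center_extend zE isT.
have [D2 zE2] := split_center_transport (f := hom_of (@pure_comb_funM p.+1))
  (@pure_comb_fun_bij p.+1) D1.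
exists ('I_p.+2 + I)%type, D2; split; last by rewrite zE2 zE1;
  apply: pure_comb_full_twist.
by rewrite card_sum card_ord -addnS cI [RHS]binS bin1 addnC.
Qed.

Theorem theorem7 (n : nat) (hn : 3 <= n) :
  let N := 'C(n.+1, 2) in
  exists (act : {grouphom Algebra.to_multiplicative 'Z_2 ->
                   group_aut (Algebra.to_multiplicative 'rV[int]_(N - 1))})
         (iota : {grouphom semidirect act -> group_aut (pure_braid n)}),
    short_exact iota (@natural_aut (pure_braid n)).
Proof.
move=> N; have n_gt0 : 0 < n by apply: leq_trans hn.
have [I [D [cI _]]] := pure_braid_split_center n_gt0.
have -> : N - 1 = #|I| by rewrite /N -cI subn1.
by exists (sgn_act I), (kernel_hom D); apply: split_center_exact.
Qed.
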